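(* Let $\mathbf J$ be the (minimal) block Jacobi operator in $l^2(\mathbb N_0;\mathbb C^p)$ with diagonal entries $\mathcal A_n=\mathcal A_n^*\in\mathbb C^{p\times p}$ and invertible off-diagonal entries $\mathcal B_n\in\mathbb C^{p\times p}$, $n\in\mathbb N_0$. Let $\mathcal A:=\mathrm{diag}\{\mathcal A_0,\mathcal A_1,\ldots,\mathcal A_n,\ldots\}$ and assume $\ker\mathcal A=\{0\}$. Suppose that for some $N\in\mathbb N_0$ $$a_1(N):=\sup_{n\ge N}\big(\|\mathcal A_n^{-1}\mathcal B_n\|+\|\mathcal A_n^{-1}\mathcal B_{n-1}^*\|\big)<\infty,\qquad a_2(N):=\sup_{n\ge N}\big(\|\mathcal A_n^{-1}\mathcal B_n\|+\|\mathcal A_{n+2}^{-1}\mathcal B_{n+1}^*\|\big)<\infty .$$ If $a_1(N)a_2(N)\le 1$, then $\mathbf J$ is essentially selfadjoint on $\mathrm{dom}\,\mathcal A\subset l^2(\mathbb N_0;\mathbb C^p)$. Moreover, if $a_1(N)a_2(N)<1$, then $\mathbf J$ is selfadjoint on $\mathrm{dom}\,\mathbf J=\mathrm{dom}\,\mathcal A$.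
   Context: Let $p\in\mathbb N$ and $\mathbb N_0=\mathbb N\cup\{0\}$. Given $\mathcal A_n=\mathcal A_n^*$ and $\mathcal B_n$ invertible in $\mathbb C^{p\times p}$, $n\in\mathbb N_0$, the block Jacobi matrix acts by $(\mathbf Jf)_n=\mathcal B_{n-1}^*f_{n-1}+\mathcal A_nf_n+\mathcal B_nf_{n+1}$ (with the term containing $f_{-1}$ omitted for $n=0$). The same letter $\mathbf J$ denotes the minimal operator, i.e. the closure in $l^2(\mathbb N_0;\mathbb C^p)$ of this map restricted to finitely supported sequences; it is closed and symmetric. The diagonal operator $\mathcal A$ acts by $(\mathcal Af)_n=\mathcal A_nf_n$ on its maximal domain $\{f\in l^2:\sum_n\|\mathcal A_nf_n\|^2<\infty\}$. Norms of matrices are operator norms. Convention: $\mathcal B_{-1}:=0$. *)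

(* Defs.v *)
From mathcomp Require Import all_boot all_order all_algebra.
From mathcomp Require Import complex.
From mathcomp Require Import all_classical all_reals all_analysis.

Set Implicit Arguments.
Unset Strict Implicit.
Unset Printing Implicit Defensive.

Import Order.TTheory GRing.Theory Num.Theory.
Import numFieldNormedType.Exports.

Local Open Scope classical_set_scope.
Local Open Scope sesquilinear_scope.
Local Open Scope complex_scope.
Local Open Scope ring_scope.

Section EuclideanSpace.
Variables (R : realType) (p : nat).

(** The canonical norm of MathComp-Analysis on ['cV[R[i]]_p] is the maximum
    norm; the Euclidean norm is needed here. *)
Definition vnorm (u : 'cV[R[i]]_p) : R :=
  Num.sqrt (\sum_(i < p) Normc.normc (u i 0) ^+ 2).

Definition vdot (u v : 'cV[R[i]]_p) : R[i] := (v^t* *m u) 0 0.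

Definition opnorm (M : 'M[R[i]]_p) : R :=
  sup [set vnorm (M *m u) | u in [set u : 'cV[R[i]]_p | vnorm u <= 1]].

End EuclideanSpace.

Notation vseq R p := (nat -> 'cV[R[i]]_p).

Section SquareSummable.
Variables (R : realType) (p : nat).

Local Notation H := (vseq R p).

Definition l2 : set H :=
  [set f | cvgn (series (fun n => vnorm (f n) ^+ 2))].

(** [l2norm] and [l2dot] are meaningful on [l2], where the series converge. *)
Definition l2norm (f : H) : R :=
  Num.sqrt (limn (series (fun n => vnorm (f n) ^+ 2))).

Definition l2dot (f g : H) : R[i] :=
  limn (series (fun n => complex.Re (vdot (f n) (g n)))) +i*
  limn (series (fun n => complex.Im (vdot (f n) (g n)))).

End SquareSummable.
Arguments l2 {R p}.

(** An unbounded operator in [l2] is represented by its graph: [T (f, g)]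
    means that [f] lies in the domain of [T] and that [T f = g]. *)
Section Operators.
Variables (R : realType) (p : nat).
Local Notation H := (vseq R p).
Implicit Type T : set (H * H).

Definition opdom T : set H := [set f | exists g, T (f, g)].

Definition opker T : set H := [set f | T (f, 0)].

Definition oprestr T (D : set H) : set (H * H) := [set x | T x /\ D x.1].

Definition opclosure T : set (H * H) :=
  [set x | [/\ l2 x.1, l2 x.2 &
     forall e : R, 0 < e -> exists y, [/\ T y, l2 y.1, l2 y.2,
       l2norm (x.1 - y.1) < e & l2norm (x.2 - y.2) < e]]].

Definition opadjoint T : set (H * H) :=
  [set x | [/\ l2 x.1, l2 x.2 &
     forall y, T y -> l2dot y.2 x.1 = l2dot y.1 x.2]].

Definition densely_defined T :=
  forall f : H, l2 f -> forall e : R, 0 < e ->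
    exists g : H, [/\ opdom T g, l2 g & l2norm (f - g) < e].

Definition symmetric_op T := densely_defined T /\ T `<=` opadjoint T.

(** Density of the domain makes [opadjoint T] the graph of a map, hence so is
    [T] in both definitions below. *)
Definition selfadjoint T := densely_defined T /\ opadjoint T = T.

Definition essentially_selfadjoint T :=
  symmetric_op T /\ selfadjoint (opclosure T).

End Operators.

Section BlockJacobi.
Variables (R : realType) (p : nat).
Local Notation H := (vseq R p).
Implicit Types A B : nat -> 'M[R[i]]_p.

(** [prev_entry B n] is the entry of index [n - 1], with the convention that the
    entry of index [-1] is [0]. *)
Definition prev_entry B n : 'M[R[i]]_p := if n is m.+1 then B m else 0.

Definition jacobi_map A B (f : H) : H := fun n =>
  (if n is m.+1 then (B m)^t* *m f m else 0) + A n *m f n + B n *m f n.+1.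

Definition finitely_supported (f : H) :=
  exists m, forall n, (m <= n)%N -> f n = 0.

Definition jacobi_op A B : set (H * H) :=
  opclosure [set x | finitely_supported x.1 /\ x.2 = jacobi_map A B x.1].

Definition diag_op A : set (H * H) :=
  [set x | [/\ l2 x.1, l2 x.2 & x.2 = (fun n => A n *m x.1 n)]].

(** When [opker (diag_op A)] is trivial, every [A n] is invertible, so that
    [invmx (A n)] below is a genuine inverse. *)
Definition a1 A B (N : nat) : \bar R :=
  ereal_sup [set (opnorm (invmx (A n) *m B n)
                  + opnorm (invmx (A n) *m (prev_entry B n)^t*))%:E
            | n in [set n | (N <= n)%N]].

Definition a2 A B (N : nat) : \bar R :=
  ereal_sup [set (opnorm (invmx (A n) *m B n)
                  + opnorm (invmx (A n.+2) *m (B n.+1)^t*))%:E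
            | n in [set n | (N <= n)%N]].

End BlockJacobi.

(* Main.v *)
Require Import Defs.
From mathcomp Require Import all_boot all_order all_algebra.
From mathcomp Require Import complex.
From mathcomp Require Import all_classical all_reals all_analysis.
From mathcomp Require Import ring lra zify.
Import Order.TTheory GRing.Theory Num.Theory.
Import numFieldNormedType.Exports.
Local Open Scope classical_set_scope.
Local Open Scope sesquilinear_scope.
Local Open Scope complex_scope.
Local Open Scope ring_scope.
Set Implicit Arguments.
Unset Strict Implicit.
Unset Printing Implicit Defensive.

(** Write [J = A + S + F], where [S] keeps the off-diagonal entries linking the
    sites [n] and [n.+1] for [n > N] and [F] the finitely many other ones, so
    that [F] is bounded and symmetric.  The blocks of [A^-1 S] are
    [(A n)^-1 B n] and [(A n)^-1 (B (n-1))^*]; their norms have row sums at most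
    [a1] and column sums at most [a2].  The Schur test, applied to the adjoint
    [S A^-1], gives [||S f|| <= t ||A f||] with [t = sqrt (a1 * a2)]
    ([schur_test]).

    From there the argument is that of Kato and Rellich for [t < 1], and that of
    Wüst for [t = 1]: for real [c != 0] the range of [J - i c] on finitely
    supported sequences is dense in [l2] (density among finitely supported data,
    [dense_range], is enough).  It suffices to find, for each datum [h], an
    approximate solution whose residual is at most [q ||h||] with a fixed
    [q < 1], and to iterate ([dense_range_contraction]).
    - For [F = 0] and [t < 1], [y = (A - i c)^-1 h] has the residual [- S y], and
      [||S y|| <= t ||A y|| <= t ||h||] ([dense_range_rel_lt1]).
    - For [F = 0] and [t = 1], one solves with [S] replaced by [(1 - s) S].  The
      residual [s S y] has norm at most [||h||] and tends weakly to [0] with [s],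
      because [S] is symmetric and [y] stays bounded; so the residual
      [(h - s S y) / 2] of [y / 2] is essentially shorter than [h]
      ([dense_range_rel_le1]).
    - Adding [F] changes the residual by [F y], of norm at most
      [||F|| / |c| * ||h||], and [c] may be taken large ([dense_range_bounded]).

    Let now [f] and [J f], computed formally, be in [l2].  Density for [c] gives
    finitely supported [y] with [(J - i c) (f - y)] small, and density for [- c]
    shows that [f - y] is then small too, by testing against solutions of
    [(J + i c) z = f - y] ([l2norm_le_shifted]).  Hence [f] is in the domain of
    the minimal operator: the minimal and the maximal operators agree
    ([jacobi_max_sub]).  Since the adjoint of the minimal operator is the maximal
    one, this is selfadjointness.  The domain of [A] lies between the finitely
    supported sequences and the maximal domain, which yields the first assertion.
    If [t < 1], then [(1 - t) ||A y|| <= ||J y|| + ||F|| ||y||] passes to the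
    closure, so that the domain of [J] is that of [A] ([opdom_jacobi_sub]). *)

(** * Scalar inequalities *)

(** Turns bilinearity and positivity into the Cauchy-Schwarz inequality, both for
    vectors and for sequences. *)
Lemma discriminant_le (R : realType) (a b c : R) :
  (forall s, 0 <= a + s * b *+ 2 + s ^+ 2 * c) -> b ^+ 2 <= a * c.
Proof.
move=> h; have a0 : 0 <= a by have := h 0; rewrite !mul0r expr0n /= mul0r; lra.
have [c0|c0|c0] := ltgtP c 0.
- have := h (1 + (`|b| *+ 2 + a) / - c).
  set t := _ / - c; have t0 : 0 <= t by rewrite divr_ge0 ?addr_ge0 ?mulrn_wge0 ?normr_ge0//; lra.
  have tc : t * c = - (`|b| *+ 2 + a) by rewrite /t; field; lra.
  have := ler_norm b; have := normr_ge0 b; nra.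
- by have := h (- b / c); rewrite (_ : _ + _ = (a * c - b ^+ 2) / c); [rewrite pmulr_lge0 ?invr_gt0// subr_ge0 | field; lra].
- have [->|b0] := eqVneq b 0; first by rewrite c0 expr0n mulr0.
  have := h (- (a + 1) / b); rewrite c0 mulr0 addr0 divfK //; lra.
Qed.

Lemma term_le_sum (R : realType) (F : nat -> R) n m :
  (forall k, 0 <= F k) -> (n < m)%N -> F n <= \sum_(0 <= k < m) F k.
Proof.
move=> F0 nm; rewrite big_mkord (bigD1 (Ordinal nm)) //= lerDl.
by apply: sumr_ge0.
Qed.

Lemma le0_epsilonM (R : realType) (C a : R) : (forall e, 0 < e -> a <= e * C) -> a <= 0.
Proof.
move=> h; rewrite leNgt; apply/negP => a0.
have C0 : 0 < C by have := h 1 ltr01; rewrite mul1r; exact: lt_le_trans.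
have := h (a / (C *+ 2)); rewrite divr_gt0 ?mulrn_wgt0 // => /(_ isT).
have -> : a / (C *+ 2) * C = a / 2 by field; rewrite gt_eqF.
by lra.
Qed.

(** Parameters for [dense_range_rel_le1]: [H] is the norm of the datum, [e] the
    admitted error, [d] the precision of the auxiliary solution and [1 - s] its
    coupling. *)
Lemma small_parameters (R : realType) (H L e : R) : 0 <= H -> 0 <= L -> 0 < e ->
  exists d s : R, [/\ 0 < d <= e, H * d * 2 + d ^+ 2 <= e ^+ 2 / 2, 0 < s <= 1 &
                  s * (L * (H + d)) * 4 <= e ^+ 2].
Proof.
move=> H0 L0 e0; have e2 : 0 < e ^+ 2 by rewrite exprn_gt0.
have He : 0 < 8 * (H + e) by rewrite mulr_gt0 // ltr_wpDl.
pose d := e ^+ 2 / (8 * (H + e)).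
have d0 : 0 < d by rewrite divr_gt0.
have dE : d * (8 * (H + e)) = e ^+ 2 by rewrite divfK // gt_eqF.
move: d d0 dE => d d0 dE.
have de : d <= e by nra.
have K0 : 0 <= L * (H + d) by rewrite mulr_ge0 // addr_ge0 // ltW.
have Ke : 0 < 4 * (L * (H + d)) + e ^+ 2 by apply: ltr_wpDl => //; exact: mulr_ge0.
exists d, (e ^+ 2 / (4 * (L * (H + d)) + e ^+ 2)); split.
- by rewrite d0.
- by nra.
- by rewrite divr_gt0 //= ler_pdivrMr // mul1r lerDr; exact: mulr_ge0.
- rewrite mulrAC -mulrA mulrAC ler_pdivrMr // ler_pM2l //.
  by rewrite mulrC lerDl ltW.
Qed.

Lemma absorb_coupling (R : realType) (s x y a : R) : x <= y -> y <= a + (1 - s) * x -> s * x <= a.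
Proof. move=> *; lra. Qed.

Lemma ereal_sup_lty (R : realType) (f : nat -> R) N :
  (ereal_sup [set (f n)%:E | n in [set n | (N <= n)%N]] < +oo)%E ->
  exists2 a, ereal_sup [set (f n)%:E | n in [set n | (N <= n)%N]] = a%:E &
             forall n, (N <= n)%N -> f n <= a.
Proof.
set S := [set _ | _ in _] => hS.
have ub n : (N <= n)%N -> ((f n)%:E <= ereal_sup S)%E.
  by move=> Nn; apply: ereal_sup_ubound; exists n.
have := ub N (leqnn N); case E : (ereal_sup S) hS => [a| |] // _ _.
by exists a => // n /ub; rewrite E lee_fin.
Qed.

(** * Euclidean vectors *)

Section Vector.
Variables (R : realType) (p : nat).
Implicit Types (u v w : 'cV[R[i]]_p) (M : 'M[R[i]]_p).

(** Most computations use the real part of the inner product only: by [vdotE]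
    and [l2dotE] the imaginary part is the real part for a vector rotated by
    [i]. *)
Definition rdot u v : R := complex.Re (vdot u v).

Lemma rdotE u v : rdot u v = \sum_(k < p)
  (complex.Re (u k 0) * complex.Re (v k 0) + complex.Im (u k 0) * complex.Im (v k 0)).
Proof.
rewrite /rdot /vdot mxE (big_morph (@complex.Re R) (id1 := 0) (op1 := +%R)  (id2 := 0) (op2 := +%R)) //; last by case=> ? ? [].
apply: eq_bigr => k _; rewrite !mxE.
by case: (u k 0) => a b; case: (v k 0) => c d /=; ring.
Qed.

Lemma rdotC u v : rdot u v = rdot v u.
Proof. by rewrite !rdotE; apply: eq_bigr => k _; ring. Qed.

Lemma rdotDl u v w : rdot (u + v) w = rdot u w + rdot v w.
Proof.
rewrite !rdotE -big_split; apply: eq_bigr => k _; rewrite !mxE.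
by case: (u k 0) => a b; case: (v k 0) => c d /=; ring.
Qed.

Lemma rdotZl (a : R) u w : rdot (a%:C *: u) w = a * rdot u w.
Proof.
rewrite !rdotE mulr_sumr; apply: eq_bigr => k _; rewrite !mxE.
by case: (u k 0) => b c /=; ring.
Qed.

Lemma rdot_i u v : rdot ('i%C *: u) v = - rdot u ('i%C *: v).
Proof.
rewrite !rdotE -sumrN; apply: eq_bigr => k _; rewrite !mxE.
by case: (u k 0) => b c; case: (v k 0) => d e /=; ring.
Qed.

Lemma rdot_adj M u v : rdot (M *m u) v = rdot u (M^t* *m v).
Proof.
by rewrite /rdot /vdot trmx_mul map_mxM trmxCK mulmxA.
Qed.

Lemma vdotE u v : vdot u v = rdot u v +i* rdot u ('i%C *: v).
Proof.
rewrite {2}/rdot (_ : vdot u ('i%C *: v) = Complex 0 (-1) * vdot u v).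
  by rewrite /rdot; case: (vdot u v) => a b /=; congr (_ +i* _); ring.
rewrite /vdot linearZ /= map_mxZ -scalemxAl mxE; congr (_ * _).
Qed.

Lemma vnormE u : vnorm u ^+ 2 = rdot u u.
Proof.
rewrite /vnorm sqr_sqrtr; last by apply: sumr_ge0 => k _; exact: sqr_ge0.
rewrite rdotE; apply: eq_bigr => k _; case: (u k 0) => a b /=.
by rewrite sqr_sqrtr ?addr_ge0 ?sqr_ge0.
Qed.

Lemma rdotDr u v w : rdot w (u + v) = rdot w u + rdot w v.
Proof. by rewrite rdotC rdotDl !(rdotC w). Qed.

Lemma rdotZr (a : R) u w : rdot w (a%:C *: u) = a * rdot w u.
Proof. by rewrite rdotC rdotZl rdotC. Qed.

Lemma rdotNl u w : rdot (- u) w = - rdot u w.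
Proof. by rewrite -scaleN1r -[-1](rmorphN1 (real_complex R)) rdotZl mulN1r. Qed.

Lemma rdotNr u w : rdot w (- u) = - rdot w u.
Proof. by rewrite rdotC rdotNl rdotC. Qed.

Lemma rdot0l u : rdot 0 u = 0.
Proof. by rewrite -(scale0r u) -[0](rmorph0 (real_complex R)) rdotZl mul0r. Qed.

Lemma rdot_ge0 u : 0 <= rdot u u.
Proof. by rewrite -vnormE sqr_ge0. Qed.

Lemma vnorm_ge0 u : 0 <= vnorm u.
Proof. exact: sqrtr_ge0. Qed.

Lemma vnorm0 : vnorm (0 : 'cV[R[i]]_p) = 0.
Proof. by apply/eqP; rewrite -sqrf_eq0 vnormE rdot0l. Qed.

Lemma vnorm_eq0 u : vnorm u = 0 -> u = 0.
Proof.
move=> u0; have := vnormE u; rewrite u0 expr0n /= rdotE => /esym/eqP.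
rewrite psumr_eq0 => [/allP h|k _]; last by rewrite addr_ge0 // -expr2 sqr_ge0.
apply/matrixP => k j; rewrite (ord1 j) mxE.
have := h k (mem_index_enum k); rewrite /= paddr_eq0 -?expr2 ?sqr_ge0 // !sqrf_eq0.
by case: (u k 0) => a b /= /andP[/eqP -> /eqP ->].
Qed.

Lemma rdot_le u v : `|rdot u v| <= vnorm u * vnorm v.
Proof.
rewrite -ler_sqr ?nnegrE ?mulr_ge0 ?vnorm_ge0 // real_normK ?num_real // exprMn !vnormE.
apply: discriminant_le => s; rewrite (_ : _ + _ = rdot (u + s%:C *: v) (u + s%:C *: v)) ?rdot_ge0 //.
rewrite !rdotDl !rdotDr !rdotZl !rdotZr (rdotC v u).
by move: (rdot u u) (rdot u v) (rdot v v) => *; ring.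
Qed.

Lemma vnormD u v : vnorm (u + v) <= vnorm u + vnorm v.
Proof.
rewrite -ler_sqr ?nnegrE ?addr_ge0 ?vnorm_ge0 // sqrrD !vnormE rdotDl !rdotDr (rdotC v u).
have := le_trans (ler_norm _) (rdot_le u v).
move: (rdot u u) (rdot u v) (rdot v v) (vnorm u * vnorm v) => *; lra.
Qed.

Lemma vnormN u : vnorm (- u) = vnorm u.
Proof.
by apply/eqP; rewrite -(@eqrXn2 _ 2) ?vnorm_ge0 // !vnormE rdotNl rdotNr opprK.
Qed.

Lemma vnorm_scale (c : R[i]) u : vnorm (c *: u) = Normc.normc c * vnorm u.
Proof.
have nc0 (z : R[i]) : 0 <= Normc.normc z by case: z => a b; exact: sqrtr_ge0.
apply/eqP; rewrite -(@eqrXn2 _ 2) ?vnorm_ge0 ?mulr_ge0 ?vnorm_ge0 //.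
rewrite exprMn !vnormE !rdotE mulr_sumr; apply/eqP; apply: eq_bigr => k _.
rewrite mxE; case: (u k 0) => a b; case: c => d e /=.
by rewrite sqr_sqrtr ?addr_ge0 ?sqr_ge0 //; ring.
Qed.

Lemma normc_le_vnorm u k : Normc.normc (u k 0) <= vnorm u.
Proof.
have nc0 (z : R[i]) : 0 <= Normc.normc z by case: z => a b; exact: sqrtr_ge0.
rewrite -ler_sqr ?nnegrE ?vnorm_ge0 //.
rewrite /vnorm sqr_sqrtr; last by apply: sumr_ge0 => j _; exact: sqr_ge0.
by rewrite (bigD1 k) //= lerDl sumr_ge0 // => j _; exact: sqr_ge0.
Qed.

Lemma mulmx_bounded M : exists2 C, 0 <= C & forall u, vnorm (M *m u) <= C * vnorm u.
Proof.
exists (\sum_j vnorm (col j M)); first by apply: sumr_ge0 => j _; exact: vnorm_ge0.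
move=> u; have -> : M *m u = \sum_j u j 0 *: col j M.
  apply/matrixP => k l; rewrite (ord1 l) mxE summxE; apply: eq_bigr => j _.
  by rewrite !mxE mulrC.
rewrite mulr_suml; elim/big_ind2 : _ => [|x a y b xa yb|j _].
- by rewrite vnorm0.
- exact: le_trans (vnormD _ _) (lerD xa yb).
- by rewrite vnorm_scale mulrC ler_wpM2l ?vnorm_ge0 ?normc_le_vnorm.
Qed.

Lemma opnorm_has_sup M :
  has_sup [set vnorm (M *m u) | u in [set u : 'cV[R[i]]_p | vnorm u <= 1]].
Proof.
split; first by exists (vnorm (M *m 0)), 0 => //=; rewrite vnorm0.
have [C C0 hC] := mulmx_bounded M; exists C => _ [u /= u1 <-].
by apply: le_trans (hC u) _; rewrite ler_piMr.
Qed.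

Lemma opnorm_ge0 M : 0 <= opnorm M.
Proof.
apply: (le_trans (vnorm_ge0 (M *m 0))); apply: sup_upper_bound (opnorm_has_sup M) _ _.
by exists 0 => //=; rewrite vnorm0.
Qed.

Lemma vnorm_mulmx M u : vnorm (M *m u) <= opnorm M * vnorm u.
Proof.
have [/vnorm_eq0 ->|u0] := eqVneq (vnorm u) 0; first by rewrite mulmx0 vnorm0 mulr0.
have up : 0 < vnorm u by rewrite lt_def u0 vnorm_ge0.
have nr : Normc.normc (vnorm u)^-1%:C = (vnorm u)^-1.
  by rewrite /= expr0n addr0 sqrtr_sqr ger0_norm // invr_ge0 vnorm_ge0.
rewrite -ler_pdivrMr // mulrC -[X in X * _]nr -vnorm_scale scalemxAr.
apply: sup_upper_bound (opnorm_has_sup M) _ _; exists ((vnorm u)^-1%:C *: u) => //=.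
by rewrite vnorm_scale nr mulVf.
Qed.

(** The bound for the adjoint comes from [|M^* u|^2 = <u, M (M^* u)>]. *)
Lemma vnorm_adjmx M u : vnorm (M^t* *m u) <= opnorm M * vnorm u.
Proof.
have [->|h] := eqVneq (vnorm (M^t* *m u)) 0.
  by rewrite mulr_ge0 ?opnorm_ge0 ?vnorm_ge0.
have hp : 0 < vnorm (M^t* *m u) by rewrite lt_def h vnorm_ge0.
rewrite -(ler_pM2l hp) -expr2 vnormE -rdot_adj rdotC.
have -> : rdot u (M *m (M^t* *m u)) = rdot (M *m (M^t* *m u)) u by exact: rdotC.
apply: le_trans (ler_norm _) (le_trans (rdot_le _ _) _).
rewrite mulrA ler_wpM2r ?vnorm_ge0 // mulrC; exact: vnorm_mulmx.
Qed.
End Vector.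

(** * Square-summable sequences *)

Section SquareSummableTheory.
Variables (R : realType) (p : nat).
Implicit Types (f g h : vseq R p) (n : nat) (e : R).

Definition ip f g : R := limn (series (fun n => rdot (f n) (g n))).

Lemma l2_bounded f (M : R) :
  (forall n, \sum_(0 <= k < n) vnorm (f k) ^+ 2 <= M) -> l2 f.
Proof.
move=> h; apply: nondecreasing_is_cvgn.
  by apply: nondecreasing_series => *; exact: sqr_ge0.
by exists M => _ [n _ <-]; exact: h.
Qed.

Lemma ip_cvg f g : l2 f -> l2 g -> cvgn (series (fun n => rdot (f n) (g n))).
Proof.
move=> lf lg; apply: normed_cvg.
apply: (@series_le_cvg _ _ ((fun n => vnorm (f n) ^+ 2) + (fun n => vnorm (g n) ^+ 2))).
- by move=> n; exact: normr_ge0.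
- by move=> n; rewrite addr_ge0 ?sqr_ge0.
- move=> n /=; apply: le_trans (rdot_le _ _) _; rewrite fctE.
  have := vnorm_ge0 (f n); have := vnorm_ge0 (g n); nra.
- exact: is_cvg_seriesD.
Qed.

Lemma l2D f g : l2 f -> l2 g -> l2 (f + g).
Proof.
move=> lf lg.
apply: (@series_le_cvg _ _ (fun n => 2 * (vnorm (f n) ^+ 2 + vnorm (g n) ^+ 2))).
- by move=> n; exact: sqr_ge0.
- by move=> n; rewrite mulr_ge0 ?addr_ge0 ?sqr_ge0.
- move=> n /=; rewrite !fctE; have := vnormD (f n) (g n).
  rewrite -ler_sqr ?nnegrE ?addr_ge0 ?vnorm_ge0 // => h; apply: le_trans h _.
  have := sqr_ge0 (vnorm (f n) - vnorm (g n)); nra.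
- exact: (is_cvg_seriesZ (k := 2) (is_cvg_seriesD lf lg)).
Qed.

Lemma l2Z (c : R[i]) f : l2 f -> l2 (c *: f).
Proof.
move=> lf; rewrite /l2 /=; under eq_fun do rewrite vnorm_scale exprMn.
exact: (is_cvg_seriesZ (k := Normc.normc c ^+ 2) lf).
Qed.

Lemma l2N f : l2 f -> l2 (- f).
Proof. by move=> lf; rewrite -scaleN1r; exact: l2Z. Qed.

Lemma l2B f g : l2 f -> l2 g -> l2 (f - g).
Proof. by move=> lf /l2N; exact: l2D. Qed.

Lemma ipC f g : ip f g = ip g f.
Proof. by congr (limn (series _)); apply/funext => n; exact: rdotC. Qed.

Lemma ipDl f g h : l2 f -> l2 g -> l2 h -> ip (f + g) h = ip f h + ip g h.
Proof.
move=> lf lg lh; rewrite /ip -lim_seriesD; try exact: ip_cvg.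
by congr (limn (series _)); apply/funext => n; exact: rdotDl.
Qed.

Lemma ipDr f g h : l2 f -> l2 g -> l2 h -> ip h (f + g) = ip h f + ip h g.
Proof. by move=> *; rewrite ipC ipDl // !(ipC h). Qed.

Lemma ipZl (a : R) f g : l2 f -> l2 g -> ip (a%:C *: f) g = a * ip f g.
Proof.
move=> lf lg; rewrite /ip -[RHS]lim_seriesZ; last exact: ip_cvg.
by congr (limn (series _)); apply/funext => n; exact: rdotZl.
Qed.

Lemma ipZr (a : R) f g : l2 f -> l2 g -> ip g (a%:C *: f) = a * ip g f.
Proof. by move=> *; rewrite ipC ipZl // ipC. Qed.

Lemma ipNl f g : l2 f -> l2 g -> ip (- f) g = - ip f g.
Proof. by move=> *; rewrite -scaleN1r -[-1](rmorphN1 (real_complex R)) ipZl // mulN1r. Qed.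

Lemma ipNr f g : l2 f -> l2 g -> ip g (- f) = - ip g f.
Proof. by move=> *; rewrite ipC ipNl // ipC. Qed.

Lemma ip_i f g : l2 f -> l2 g -> ip ('i%C *: f) g = - ip f ('i%C *: g).
Proof.
move=> lf lg; rewrite -ipNr //; last exact: l2Z.
by congr (limn (series _)); apply/funext => n; rewrite rdot_i -rdotNr.
Qed.

Lemma l2dotE f g : l2dot f g = ip f g +i* ip f ('i%C *: g).
Proof.
by congr (limn (series _) +i* limn (series _)); apply/funext => n; rewrite vdotE.
Qed.

Lemma l2norm_ge0 f : 0 <= l2norm f.
Proof. exact: sqrtr_ge0. Qed.

Lemma l2norm_sum f n : l2 f -> \sum_(0 <= k < n) vnorm (f k) ^+ 2 <= l2norm f ^+ 2.
Proof.
move=> lf; have nd : nondecreasing_seq (series (fun k => vnorm (f k) ^+ 2)).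
  by apply: nondecreasing_series => *; exact: sqr_ge0.
have le := nondecreasing_cvgn_le nd lf; rewrite sqr_sqrtr; first exact: le.
by have := le 0%N; rewrite /series /= big_geq.
Qed.

Lemma l2norm_le f (M : R) : 0 <= M ->
  (forall n, \sum_(0 <= k < n) vnorm (f k) ^+ 2 <= M ^+ 2) -> l2norm f <= M.
Proof.
move=> M0 h; rewrite -[leRHS]ger0_norm // -sqrtr_sqr ler_wsqrtr //.
by apply: limr_le; [exact: l2_bounded h | exact: nearW].
Qed.

Lemma ip_norm f : l2 f -> ip f f = l2norm f ^+ 2.
Proof.
move=> lf; rewrite sqr_sqrtr.
  by congr (limn (series _)); apply/funext => n; rewrite vnormE.
apply: limr_ge => //; apply: nearW => n; apply: sumr_ge0 => *; exact: sqr_ge0.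
Qed.

Lemma l2normZ (c : R[i]) f : l2 f -> l2norm (c *: f) = Normc.normc c * l2norm f.
Proof.
move=> lf; have n0 : 0 <= Normc.normc c by case: c => a b; exact: sqrtr_ge0.
rewrite /l2norm -[Normc.normc c in RHS]ger0_norm // -sqrtr_sqr -sqrtrM ?sqr_ge0 //.
congr Num.sqrt; rewrite -[RHS](lim_seriesZ (Normc.normc c ^+ 2)) //.
by congr (limn (series _)); apply/funext => n; rewrite vnorm_scale exprMn.
Qed.

Lemma l2normN f : l2norm (- f) = l2norm f.
Proof.
by congr (Num.sqrt (limn (series _))); apply/funext => n; rewrite vnormN.
Qed.

Lemma l2norm_cvg f : l2 f -> series (fun n => vnorm (f n) ^+ 2) @ \oo --> l2norm f ^+ 2.
Proof.
by move=> lf; rewrite -ip_norm // /ip; under eq_fun do rewrite vnormE; exact: ip_cvg.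
Qed.

#[local] Opaque l2 ip l2norm.

Lemma ip_le f g : l2 f -> l2 g -> `|ip f g| <= l2norm f * l2norm g.
Proof.
move=> lf lg; rewrite -ler_sqr ?nnegrE ?mulr_ge0 ?l2norm_ge0 // real_normK ?num_real //.
rewrite exprMn -(ip_norm lf) -(ip_norm lg); apply: discriminant_le => s.
have lsg : l2 (s%:C *: g) by exact: l2Z.
have lD : l2 (f + s%:C *: g) by exact: l2D.
have := sqr_ge0 (l2norm (f + s%:C *: g)); rewrite -(ip_norm lD).
rewrite (ipDl lf lsg lD) (ipDr lf lsg lf) (ipDr lf lsg lsg).
rewrite (ipZl s lg lf) (ipZl s lg lsg) !(ipZr s lg) // (ipC g f).
move: (ip f f) (ip f g) (ip g g) => *; nra.
Qed.

Lemma l2normD f g : l2 f -> l2 g -> l2norm (f + g) <= l2norm f + l2norm g.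
Proof.
move=> lf lg; rewrite -ler_sqr ?nnegrE ?addr_ge0 ?l2norm_ge0 //.
have lD := l2D lf lg.
rewrite sqrrD -(ip_norm lf) -(ip_norm lg) -(ip_norm lD).
rewrite (ipDl lf lg lD) (ipDr lf lg lf) (ipDr lf lg lg) (ipC g f).
have := le_trans (ler_norm _) (ip_le lf lg).
move: (ip f f) (ip f g) (ip g g) (l2norm f * l2norm g) => *; lra.
Qed.

Lemma l2normB f g : l2 f -> l2 g -> l2norm (f - g) <= l2norm f + l2norm g.
Proof. by move=> lf lg; rewrite -(l2normN g); exact: l2normD (l2N lg). Qed.

Lemma l2norm0 : l2norm (0 : vseq R p) = 0.
Proof.
apply/eqP; rewrite eq_le l2norm_ge0 andbT; apply: l2norm_le => // n.
by rewrite big1 ?expr0n // => k _; rewrite vnorm0 expr0n.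
Qed.

Lemma finitely_supportedD f g :
  finitely_supported f -> finitely_supported g -> finitely_supported (f + g).
Proof.
move=> [m hm] [n hn]; exists (m + n)%N => k mnk.
by rewrite fctE hm ?hn ?addr0 //; lia.
Qed.

Lemma finitely_supportedZ (c : R[i]) f :
  finitely_supported f -> finitely_supported (c *: f).
Proof. by move=> [m hm]; exists m => k mk; rewrite fctE hm // scaler0. Qed.

Lemma finitely_supportedB f g :
  finitely_supported f -> finitely_supported g -> finitely_supported (f - g).
Proof.
by move=> hf hg; rewrite -(scaleN1r g); apply/finitely_supportedD/finitely_supportedZ.
Qed.

Lemma finitely_supported_l2 f : finitely_supported f -> l2 f.
Proof.
move=> [m hm]; apply: (@l2_bounded _ (\sum_(0 <= k < m) vnorm (f k) ^+ 2)) => n.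
have [nm|mn] := leqP n m.
  by rewrite (big_cat_nat (leq0n _) nm) //= lerDl; apply: sumr_ge0 => *; exact: sqr_ge0.
rewrite (big_cat_nat (leq0n _) (ltnW mn)) //= (_ : \sum_(m <= k < n) _ = 0) ?addr0 //.
rewrite big_nat_cond big1 // => k /andP[/andP[mk _] _].
by rewrite hm // vnorm0 expr0n.
Qed.

Lemma finitely_supported_dense f e : l2 f -> 0 < e ->
  exists2 y : vseq R p, finitely_supported y & l2norm (f - y) < e.
Proof.
move=> lf e0; have e2 : 0 < (e / 2) ^+ 2 by rewrite exprn_gt0 // divr_gt0.
have /cvgrPdist_lt/(_ _ e2) [m _ hm] := l2norm_cvg lf.
pose y : vseq R p := fun n => if (n < m)%N then f n else 0.
exists y; first by exists m => n mn; rewrite /y ltnNge mn.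
apply: (@le_lt_trans _ _ (e / 2)); last lra.
apply: l2norm_le => [|n]; first by lra.
have := hm _ (leqnn m); rewrite /= => /(le_lt_trans (ler_norm _)) /ltW hm'.
apply: le_trans hm'; rewrite lerBrDl.
apply: le_trans (l2norm_sum (m + n) lf); rewrite (big_cat_nat (leq0n _) (leq_addr n m)) //= lerD2l.
have [nm|mn] := leqP n m.
  rewrite big_nat_cond big1; first by apply: sumr_ge0 => *; exact: sqr_ge0.
  by move=> k /andP[/andP[_ kn] _]; rewrite !fctE /y (leq_trans kn nm) subrr vnorm0 expr0n.
rewrite (big_cat_nat (leq0n _) (ltnW mn)) //= big_nat_cond big1 ?add0r; last first.
  by move=> k /andP[/andP[_ kn] _]; rewrite !fctE /y kn subrr vnorm0 expr0n.
rewrite (big_cat_nat (ltnW mn) (leq_addl m n)) //= ler_wpDr ?sumr_ge0//.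
  by move=> *; exact: sqr_ge0.
rewrite big_nat_cond [leRHS]big_nat_cond le_eqVlt; apply/orP; left; apply/eqP.
by apply: eq_bigr => k /andP[/andP[mk _] _]; rewrite !fctE /y ltnNge mk subr0.
Qed.

End SquareSummableTheory.
Arguments l2Z {R p} c {f}.

(** * The formal Jacobi map *)

Section JacobiTheory.
Variables (R : realType) (p : nat).
Implicit Types (f g h x y z : vseq R p) (A B : nat -> 'M[R[i]]_p) (c e : R).

Lemma addseqE f g n : (f + g) n = f n + g n. Proof. by []. Qed.

Lemma scaleseqE (a : R[i]) f n : (a *: f) n = a *: f n. Proof. by []. Qed.

Lemma ip_finite f g m : (forall n, (m <= n)%N -> rdot (f n) (g n) = 0) ->
  ip f g = \sum_(0 <= k < m) rdot (f k) (g k).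
Proof.
move=> h; apply: norm_lim_near_cst; exists m => // n /= mn.
rewrite /series /= (big_cat_nat (leq0n m) mn) //= (_ : \sum_(m <= k < n) _ = 0) ?addr0 //.
by rewrite big_nat_cond big1 // => k /andP[/andP[mk _] _]; exact: h.
Qed.

(** The sequences are arbitrary here: the finitely supported ones test every
    entry, which identifies an adjoint with a formal expression. *)
Lemma ip_separates f g :
  (forall y, finitely_supported y -> ip y f = ip y g) -> f = g.
Proof.
move=> fg; apply/funext => n; apply/eqP; rewrite -subr_eq0; apply/eqP.
apply: vnorm_eq0; apply/eqP; rewrite -sqrf_eq0 vnormE.
pose y : vseq R p := fun k => if k == n then f n - g n else 0.
have ipy x : ip y x = rdot (f n - g n) (x n).
  rewrite (@ip_finite _ _ n.+1) => [|k nk]; last first.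
    by rewrite /y ifN ?rdot0l //; lia.
  rewrite big_nat_recr //= big_nat_cond big1 => [|k /andP[/andP[_ kn] _]].
    by rewrite /y eqxx add0r.
  by rewrite /y ifN ?rdot0l //; lia.
rewrite rdotDr rdotNr -!ipy fg ?subrr //.
by exists n.+1 => k nk; rewrite /y ifN //; lia.
Qed.

Lemma jacobi_map0 A B f : jacobi_map A B f 0%N = A 0%N *m f 0%N + B 0%N *m f 1%N.
Proof. by rewrite /jacobi_map add0r. Qed.

Lemma jacobi_mapS A B f n : jacobi_map A B f n.+1 =
  (B n)^t* *m f n + A n.+1 *m f n.+1 + B n.+1 *m f n.+2.
Proof. by []. Qed.

#[local] Opaque l2 l2norm ip jacobi_map.

Lemma jacobi_mapD A B f g :
  jacobi_map A B (f + g) = jacobi_map A B f + jacobi_map A B g.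
Proof.
apply/funext => -[|n].
  by rewrite addseqE !jacobi_map0 !addseqE !mulmxDr addrACA.
by rewrite addseqE !jacobi_mapS !addseqE !mulmxDr [RHS]addrACA; congr (_ + _); exact: addrACA.
Qed.

Lemma jacobi_mapZ A B (a : R[i]) f : jacobi_map A B (a *: f) = a *: jacobi_map A B f.
Proof.
apply/funext => -[|n]; rewrite scaleseqE.
  by rewrite !jacobi_map0 !scaleseqE -!scalemxAr scalerDr.
by rewrite !jacobi_mapS !scaleseqE -!scalemxAr !scalerDr.
Qed.

Lemma jacobi_mapB A B f g :
  jacobi_map A B (f - g) = jacobi_map A B f - jacobi_map A B g.
Proof. by rewrite -scaleN1r jacobi_mapD jacobi_mapZ scaleN1r. Qed.

Lemma finitely_supported_jacobi A B y :
  finitely_supported y -> finitely_supported (jacobi_map A B y).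
Proof.
move=> [m hm]; exists m.+1 => -[//|n] mn.
by rewrite jacobi_mapS !hm ?mulmx0 ?addr0 //; lia.
Qed.

(** Green's formula: the terms inside cancel by hermitian symmetry and only the
    link leaving the segment contributes. *)
Lemma green A B f g m : (forall n, A n = (A n)^t*) ->
  \sum_(0 <= k < m.+1) (rdot (jacobi_map A B f k) (g k) - rdot (f k) (jacobi_map A B g k))
  = rdot (B m *m f m.+1) (g m) - rdot (f m) (B m *m g m.+1).
Proof.
move=> hA; elim: m => [|m IH].
  rewrite big_nat1 !jacobi_map0 !(rdotDl, rdotDr).
  have -> : rdot (A 0%N *m f 0%N) (g 0%N) = rdot (f 0%N) (A 0%N *m g 0%N).
    by rewrite rdot_adj -hA.
  by rewrite opprD addrACA subrr add0r.
rewrite big_nat_recr; last exact: leq0n.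
rewrite IH.
rewrite !jacobi_mapS !(rdotDl, rdotDr).
have -> : rdot ((B m)^t* *m f m) (g m.+1) = rdot (f m) (B m *m g m.+1).
  by rewrite rdot_adj trmxCK.
have -> : rdot (f m.+1) ((B m)^t* *m g m) = rdot (B m *m f m.+1) (g m).
  by rewrite rdot_adj.
have -> : rdot (A m.+1 *m f m.+1) (g m.+1) = rdot (f m.+1) (A m.+1 *m g m.+1).
  by rewrite rdot_adj -hA.
have cancel (x y z s t : R) : x - y + (y + z + s - (x + z + t)) = s - t by ring.
exact: cancel.
Qed.

Lemma jacobi_symmetric A B y x : (forall n, A n = (A n)^t*) ->
  finitely_supported y -> ip (jacobi_map A B y) x = ip y (jacobi_map A B x).
Proof.
move=> hA fy; have [m hm] := fy; have [m' hm'] := finitely_supported_jacobi A B fy.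
rewrite !(@ip_finite _ _ (m + m').+1) => [|n mn|n mn]; last 2 first.
- by rewrite hm ?rdot0l //; lia.
- by rewrite hm' ?rdot0l //; lia.
apply/eqP; rewrite -subr_eq0 -sumrB green //.
by rewrite !hm ?mulmx0 ?rdot0l ?subrr //; lia.
Qed.

Lemma ip_i_i f g : l2 f -> l2 g -> ip ('i%C *: f) ('i%C *: g) = ip f g.
Proof.
move=> lf lg; by rewrite (ip_i lf (l2Z _ lg)) scalerA -expr2 sqr_i scaleN1r (ipNr lg lf) opprK.
Qed.

(** The formal expression of [J - i c]. *)
Definition shifted A B c f : vseq R p := jacobi_map A B f - c%:C *: ('i%C *: f).

Lemma shiftedD A B c f g : shifted A B c (f + g) = shifted A B c f + shifted A B c g.
Proof. by rewrite /shifted jacobi_mapD !scalerDr opprD addrACA. Qed.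

Lemma shiftedZ A B c (a : R) f : shifted A B c (a%:C *: f) = a%:C *: shifted A B c f.
Proof.
rewrite /shifted jacobi_mapZ scalerBr !scalerA; congr (_ - _ *: _); ring.
Qed.

Lemma shiftedE A B c f : shifted A B c f = jacobi_map A B f - c%:C *: ('i%C *: f).
Proof. by []. Qed.

Lemma shiftedB A B c f g : shifted A B c (f - g) = shifted A B c f - shifted A B c g.
Proof.
by rewrite -(scaleN1r g) -[-1](rmorphN1 (real_complex R)) shiftedD shiftedZ rmorphN1 scaleN1r.
Qed.

Lemma finitely_supported_shifted A B c y :
  finitely_supported y -> finitely_supported (shifted A B c y).
Proof.
move=> fy; apply: finitely_supportedB; first exact: finitely_supported_jacobi.
by do 2!apply: finitely_supportedZ.
Qed.

(** The orthogonality holds when [g] is the image of [f] under a symmetric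
    operator. *)
Lemma l2norm_orthogonal f g c : l2 f -> l2 g -> ip g ('i%C *: f) = 0 ->
  l2norm (g - c%:C *: ('i%C *: f)) ^+ 2 = l2norm g ^+ 2 + c ^+ 2 * l2norm f ^+ 2.
Proof.
move=> lf lg gf0.
have [h eh] : exists h, h = 'i%C *: f by eexists.
have lh : l2 h by rewrite eh; exact: l2Z.
rewrite -(ip_norm lf) -(ip_norm lg) -(ip_i_i lf lf) -eh; rewrite -eh in gf0.
have lch : l2 (c%:C *: h) by exact: l2Z.
move: (ip_norm (l2B lg lch)) => <-.
rewrite (ipDl lg (l2N lch) (l2B lg lch)) (ipNl lch (l2B lg lch)) (ipZl c lh (l2B lg lch)).
rewrite (ipDr lg (l2N lch) lg) (ipNr lch lg) (ipZr c lh lg).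
rewrite (ipDr lg (l2N lch) lh) (ipNr lch lh) (ipZr c lh lh).
by rewrite (ipC h g) gf0 mulr0 oppr0 addr0 add0r mulrN opprK mulrA -expr2.
Qed.

Lemma shifted_norm A B c y : (forall n, A n = (A n)^t*) -> finitely_supported y ->
  l2norm (shifted A B c y) ^+ 2 = l2norm (jacobi_map A B y) ^+ 2 + c ^+ 2 * l2norm y ^+ 2.
Proof.
move=> hA fy; have ly := finitely_supported_l2 fy.
have lJ := finitely_supported_l2 (finitely_supported_jacobi A B fy).
apply: l2norm_orthogonal => //.
have h : ip (jacobi_map A B y) ('i%C *: y) = - ip (jacobi_map A B y) ('i%C *: y).
  rewrite {1}jacobi_symmetric // jacobi_mapZ.
  by rewrite (ipC (jacobi_map A B y)) (ip_i ly lJ) opprK.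
lra.
Qed.

#[local] Opaque shifted.

(** [J - i c] is bounded below by [c] because [J] is symmetric, so that the
    approximate solutions below are controlled by their data. *)
Lemma shifted_bounds A B c y : (forall n, A n = (A n)^t*) -> finitely_supported y ->
  l2norm (jacobi_map A B y) <= l2norm (shifted A B c y) /\
  `|c| * l2norm y <= l2norm (shifted A B c y).
Proof.
move=> hA fy; have := shifted_norm B c hA fy.
move: (l2norm_ge0 y) (l2norm_ge0 (jacobi_map A B y)) (l2norm_ge0 (shifted A B c y)).
move: (l2norm y) (l2norm (jacobi_map A B y)) (l2norm (shifted A B c y)) => u v w u0 v0 w0 h.
split; rewrite -ler_sqr ?nnegrE ?mulr_ge0 ?normr_ge0 // h.
  by rewrite lerDl mulr_ge0 ?sqr_ge0.
by rewrite exprMn real_normK ?num_real // lerDr sqr_ge0.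
Qed.

Definition dense_range A B c :=
  forall h, finitely_supported h -> forall e, 0 < e ->
  exists2 y, finitely_supported y & l2norm (h - shifted A B c y) < e.

(** Iterating an approximate solution whose residual is smaller than the datum
    by a fixed factor [q < 1] solves the equation up to any precision. *)
Lemma dense_range_contraction A B c (q : R) : 0 <= q < 1 ->
  (forall h, finitely_supported h -> forall e, 0 < e ->
     exists2 y, finitely_supported y & l2norm (h - shifted A B c y) <= q * l2norm h + e) ->
  dense_range A B c.
Proof.
move=> /andP[q0 q1] H h fh e e0.
have step k : forall e, 0 < e -> exists2 y, finitely_supported y &
    l2norm (h - shifted A B c y) <= q ^+ k * l2norm h + e.
  elim: k => [|k IH] d d0.
    have f0 : finitely_supported (0 : vseq R p) by exists 0%N.
    exists 0 => //; rewrite expr0 mul1r.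
    have -> : shifted A B c 0 = 0.
      by have := shiftedZ A B c 0 0; rewrite rmorph0 !scale0r.
    by rewrite subr0; lra.
  have d2 : 0 < d / 2 by lra.
  have [y fy hy] := IH _ d2.
  have fr : finitely_supported (h - shifted A B c y).
    by apply: finitely_supportedB => //; exact: finitely_supported_shifted.
  have [z fz hz] := H _ fr _ d2.
  exists (y + z); first exact: finitely_supportedD.
  rewrite shiftedD opprD addrA; apply: le_trans hz _.
  rewrite exprS -mulrA; have := ler_wpM2l q0 hy; nra.
have := l2norm_ge0 h => h0.
have /cvgrPdist_lt/(_ (e / 2 / (l2norm h + 1))) [|k _ hk] : (fun k => q ^+ k) @ \oo --> (0 : R).
- by apply: cvg_expr; rewrite ger0_norm.
- by rewrite !divr_gt0 //; lra.
have [|y fy hy] := step k (e / 2); first by lra.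
exists y => //; apply: le_lt_trans hy _.
have := hk _ (leqnn k); rewrite /= sub0r normrN ger0_norm ?exprn_ge0 //.
rewrite ltr_pdivlMr; last by lra.
have := exprn_ge0 k q0; nra.
Qed.
End JacobiTheory.

(** * Minimal and maximal operators *)

Section JacobiOperators.
Variables (R : realType) (p : nat) (A B : nat -> 'M[R[i]]_p).
Hypothesis hA : forall n, A n = (A n)^t*.
Implicit Types (f g h y z : vseq R p) (T : set (vseq R p * vseq R p)).

#[local] Opaque l2 l2norm ip jacobi_map shifted.

(** Relations of the form [<T y, f> = <y, g>] are stable under closure of [T]; this
    makes adjoints closed and insensitive to closure. *)
Lemma opclosure_ip T x f g : opclosure T x -> l2 f -> l2 g ->
  (forall y : vseq R p * vseq R p, T y -> l2 y.1 -> l2 y.2 -> ip y.2 f = ip y.1 g) ->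
  ip x.2 f = ip x.1 g.
Proof.
case: x => x1 x2 /= [/= lx1 lx2 hx] lf lg hT; apply/eqP; rewrite -subr_eq0.
rewrite -normr_le0; apply: (@le0_epsilonM _ (l2norm f + l2norm g)) => e e0.
have [[y1 y2] /= [Ty ly1 ly2 h1 h2]] := hx e e0.
have E : ip x2 f - ip x1 g = ip (x2 - y2) f - ip (x1 - y1) g.
  rewrite (ipDl lx2 (l2N ly2) lf) (ipDl lx1 (l2N ly1) lg) (ipNl ly2 lf) (ipNl ly1 lg).
  by have /= -> := hT _ Ty ly1 ly2; ring.
rewrite E; apply: le_trans (ler_normB _ _) _; rewrite mulrDr; apply: lerD.
- apply: le_trans (ip_le (l2B lx2 ly2) lf) _; apply: ler_wpM2r (l2norm_ge0 _) _ _ (ltW h2).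
- apply: le_trans (ip_le (l2B lx1 ly1) lg) _; apply: ler_wpM2r (l2norm_ge0 _) _ _ (ltW h1).
Qed.

Definition jacobi_fin : set (vseq R p * vseq R p) :=
  [set x | finitely_supported x.1 /\ x.2 = jacobi_map A B x.1].

Definition jacobi_max : set (vseq R p * vseq R p) :=
  [set x | [/\ l2 x.1, l2 x.2 & x.2 = jacobi_map A B x.1]].

Lemma jacobi_fin_max : jacobi_fin `<=` jacobi_max.
Proof.
move=> -[f g] [/= ff ->]; split => //=; apply: finitely_supported_l2 => //.
exact: finitely_supported_jacobi.
Qed.

Lemma sub_opclosure T : (forall x, T x -> l2 x.1 /\ l2 x.2) -> T `<=` opclosure T.
Proof.
move=> hT x Tx; have [l1 l2'] := hT _ Tx; split => // e e0.
by exists x; split => //; rewrite subrr l2norm0.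
Qed.

Lemma opclosure_jacobi_max T : T `<=` jacobi_max -> opclosure T `<=` jacobi_max.
Proof.
move=> hT [f g] cfg; have [/= lf lg _] := cfg; split => //=.
apply: ip_separates => y fy; have ly := finitely_supported_l2 fy.
have lJ := finitely_supported_l2 (finitely_supported_jacobi A B fy).
rewrite -jacobi_symmetric // ipC (ipC _ f).
apply: (@opclosure_ip _ _ y (jacobi_map A B y) cfg ly lJ) => -[y1 y2] /hT[/= _ _ ->] _ _.
by rewrite ipC -jacobi_symmetric // ipC.
Qed.

Lemma opadjoint_jacobi_max T : jacobi_fin `<=` T -> opadjoint T `<=` jacobi_max.
Proof.
move=> hT [f g] [/= lf lg hfg]; split => //=.
apply: ip_separates => y fy; rewrite -jacobi_symmetric //.
have /(congr1 (@complex.Re R)) := hfg (y, jacobi_map A B y) (hT (y, _) (conj fy erefl)).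
by rewrite !l2dotE /= => ->.
Qed.

Lemma jacobi_max_opadjoint : jacobi_max `<=` opadjoint (jacobi_op A B).
Proof.
move=> [f g] [/= lf lg eg]; split => [//|//|y Ty]; rewrite !l2dotE /=.
have <- : ip y.2 f = ip y.1 g.
  apply: (opclosure_ip Ty lf lg) => -[y1 y2] [/= fy ->] _ _.
  by rewrite /= eg (@jacobi_symmetric _ _ A B _ _ hA fy).
have <- // : ip y.2 ('i%C *: f) = ip y.1 ('i%C *: g).
apply: (opclosure_ip Ty (l2Z _ lf) (l2Z _ lg)) => -[y1 y2] [/= fy ->] _ _.
by rewrite /= eg (@jacobi_symmetric _ _ A B _ _ hA fy) jacobi_mapZ.
Qed.

Lemma l2_densely_defined T :
  (forall f, finitely_supported f -> opdom T f) -> densely_defined T.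
Proof.
move=> hT f lf e e0; have [y fy hy] := finitely_supported_dense lf e0.
by exists y; split; [exact: hT | exact: finitely_supported_l2 |].
Qed.

Lemma l2_shifted c f : l2 f -> l2 (jacobi_map A B f) -> l2 (shifted A B c f).
Proof. by move=> lf lJ; rewrite shiftedE; exact: l2B lJ (l2Z _ (l2Z _ lf)). Qed.
Arguments l2_shifted c {f}.

Lemma shifted_adjoint c z f : finitely_supported z ->
  l2 f -> l2 (jacobi_map A B f) ->
  ip (shifted A B (- c) z) f = ip z (shifted A B c f).
Proof.
move=> fz lf lJ; have lz := finitely_supported_l2 fz.
have lJz := finitely_supported_l2 (finitely_supported_jacobi A B fz).
have liz : l2 ('i%C *: z) by exact: l2Z.
have lif : l2 ('i%C *: f) by exact: l2Z.
have lciz : l2 ((- c)%:C *: ('i%C *: z)) by exact: l2Z.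
have lcif : l2 (c%:C *: ('i%C *: f)) by exact: l2Z.
rewrite !shiftedE (ipDl lJz (l2N lciz) lf) (ipNl lciz lf) (ipZl (- c) liz lf) (ip_i lz lf).
rewrite (ipDr lJ (l2N lcif) lz) (ipNr lcif lz) (ipZr c lif lz) jacobi_symmetric //.
by rewrite mulrNN.
Qed.

(** The lower bound of [shifted_bounds] on the maximal domain, where [J] is not
    known to be symmetric.  It is recovered by duality: [||f||^2] is nearly
    [<f, (J + i c) z> = <(J - i c) f, z>] for a finitely supported [z] with
    [c ||z|| <= ||f||], up to errors. *)
Lemma l2norm_le_shifted c f : 0 < c -> dense_range A B (- c) ->
  l2 f -> l2 (jacobi_map A B f) ->
  c * l2norm f <= l2norm (shifted A B c f).
Proof.
move=> c0 hd lf lJ; have lS := l2_shifted c lf lJ.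
suff h : l2norm f * (c * l2norm f - l2norm (shifted A B c f)) <= 0.
  have [f0|f0] := eqVneq (l2norm f) 0; first by rewrite f0 mulr0 l2norm_ge0.
  by move: h; rewrite pmulr_rle0 ?subr_le0 // lt_def f0 l2norm_ge0.
apply: (@le0_epsilonM _ ((c * l2norm f + l2norm (shifted A B c f)) * 2)) => e e0.
have [f' ff' hf'] := finitely_supported_dense lf e0.
have [z fz hz] := hd _ ff' _ e0.
have lf' := finitely_supported_l2 ff'; have lz := finitely_supported_l2 fz.
have [Z eZ] : exists Z, Z = shifted A B (- c) z by eexists.
have lZ : l2 Z.
  by rewrite eZ; apply: finitely_supported_l2; exact: finitely_supported_shifted.
have fZ : l2norm (f - Z) <= e * 2.
  rewrite -(subrKA f'); apply: le_trans (l2normD (l2B lf lf') (l2B lf' lZ)) _.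
  by rewrite eZ mulr_natr mulr2n; exact: lerD (ltW hf') (ltW hz).
have zZ : c * l2norm z <= l2norm f + e * 2.
  have [_] := shifted_bounds B (- c) hA fz; rewrite normrN gtr0_norm // => h.
  apply: le_trans h _; rewrite -eZ -[Z](subKr f).
  by apply: le_trans (l2normB lf (l2B lf lZ)) _; rewrite lerD2l.
have ff : l2norm f ^+ 2 <= l2norm f * (e * 2) + l2norm z * l2norm (shifted A B c f).
  rewrite -(ip_norm lf) -{2}(subrK Z f) (ipDr (l2B lf lZ) lZ lf); apply: lerD.
    apply: le_trans (ler_norm _) _; apply: le_trans (ip_le lf (l2B lf lZ)) _.
    by rewrite ler_wpM2l ?l2norm_ge0.
  rewrite ipC eZ shifted_adjoint //.
  by apply: le_trans (ler_norm _) _; exact: ip_le.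
move: (l2norm_ge0 f) (l2norm_ge0 (shifted A B c f)) fZ zZ ff.
move: (l2norm f) (l2norm z) (l2norm (shifted A B c f)) => a u s a0 s0 _ cu aa.
have := ler_wpM2l (ltW c0) aa; have := ler_wpM2r s0 cu; nra.
Qed.

(** The equation [(J - i c) y = (J - i c) f] is solved approximately by finitely
    supported [y]; the residual controls both [f - y] and [J (f - y)]. *)
Lemma jacobi_max_sub (c : R) : 0 < c -> dense_range A B c -> dense_range A B (- c) ->
  jacobi_max `<=` jacobi_op A B.
Proof.
move=> c0 hd hd' [f g] [/= lf lg eg]; split => // e e0.
have lJ : l2 (jacobi_map A B f) by rewrite -eg.
have lS := l2_shifted c lf lJ.
(* The residual, at most [2 d], has to stay below [e * c] for the bound on
   [f - y] and below [e / 2] for that on [J (f - y)]. *)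
pose d := Num.min (e * c) e / 8.
have d0 : 0 < d by rewrite divr_gt0 // lt_min mulr_gt0 ?e0.
have dc : d * 8 <= e * c by rewrite /d divfK ?ge_min ?lexx // pnatr_eq0.
have de : d * 8 <= e by rewrite /d divfK ?ge_min ?lexx ?orbT // pnatr_eq0.
have d2 : d * 2 < e * c by move: d d0 dc de => d *; lra.
have d4 : d * 2 + d * 2 < e by move: d d0 dc de d2 => d *; lra.
have [h fh hh] := finitely_supported_dense lS d0.
have [y fy hy] := hd _ fh _ d0.
have lh := finitely_supported_l2 fh; have ly := finitely_supported_l2 fy.
have lJy := finitely_supported_l2 (finitely_supported_jacobi A B fy).
have lSy := finitely_supported_l2 (finitely_supported_shifted A B c fy).
have lw := l2B lf ly.
have lJw : l2 (jacobi_map A B (f - y)) by rewrite jacobi_mapB; exact: l2B.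
have Sw : l2norm (shifted A B c (f - y)) <= d * 2.
  have -> : shifted A B c (f - y) = (shifted A B c f - h) + (h - shifted A B c y).
    by rewrite subrKA shiftedB.
  by apply: le_trans (l2normD (l2B lS lh) (l2B lh lSy)) _; rewrite mulr_natr mulr2n; exact: lerD (ltW hh) (ltW hy).
have cw := le_trans (l2norm_le_shifted c0 hd' lw lJw) Sw.
exists (y, jacobi_map A B y); split => //=.
- by rewrite -(ltr_pM2l c0) (mulrC c e); exact: le_lt_trans cw d2.
- rewrite eg -jacobi_mapB.
  have liw : l2 ('i%C *: (f - y)) by exact: l2Z.
  have -> : jacobi_map A B (f - y) = shifted A B c (f - y) + c%:C *: ('i%C *: (f - y)).
    by rewrite shiftedE subrK.
  apply: le_lt_trans (l2normD (l2_shifted c lw lJw) (l2Z _ liw)) _.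
  rewrite (l2normZ _ liw) (l2normZ _ lw) /= expr0n expr1n add0r sqrtr1 mul1r addr0.
  by rewrite sqrtr_sqr (gtr0_norm c0); exact: le_lt_trans (lerD Sw cw) d4.
Qed.
End JacobiOperators.

(** * Relative bounds and density of the range *)

Section Perturbation.
Variables (R : realType) (p : nat).
Implicit Types (f g h y z : vseq R p) (A B : nat -> 'M[R[i]]_p) (c e t : R).

Lemma l2_dominated f g : l2 g -> (forall n, vnorm (f n) <= vnorm (g n)) ->
  l2 f /\ l2norm f <= l2norm g.
Proof.
move=> lg fg; have h n : \sum_(0 <= k < n) vnorm (f k) ^+ 2 <= l2norm g ^+ 2.
  apply: le_trans (l2norm_sum n lg); apply: ler_sum => k _.
  by rewrite ler_sqr ?nnegrE ?vnorm_ge0.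
by split; [exact: l2_bounded h | exact: l2norm_le (l2norm_ge0 g) h].
Qed.

Definition diag_map A f : vseq R p := fun n => A n *m f n.

Definition offdiag B f : vseq R p := jacobi_map (fun=> 0) B f.

Lemma offdiag0 B f : offdiag B f 0%N = B 0%N *m f 1%N.
Proof. by rewrite /offdiag jacobi_map0 mul0mx add0r. Qed.

Lemma offdiagS B f n : offdiag B f n.+1 = (B n)^t* *m f n + B n.+1 *m f n.+2.
Proof. by rewrite /offdiag jacobi_mapS mul0mx addr0. Qed.

Lemma jacobi_map_split A B f : jacobi_map A B f = diag_map A f + offdiag B f.
Proof.
apply/funext => -[|n]; rewrite [RHS]addseqE ?offdiag0 ?offdiagS.
  exact: jacobi_map0.
by rewrite jacobi_mapS addrCA addrA.
Qed.

Lemma offdiagD B B' f : offdiag (B + B') f = offdiag B f + offdiag B' f.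
Proof.
apply/funext => -[|n]; rewrite addseqE ?offdiag0 ?offdiagS.
  by rewrite [(B + B') _]/(_ + _) mulmxDl.
rewrite [(B + B') n]/(_ + _) [(B + B') n.+1]/(_ + _) linearD /= map_mxD !mulmxDl.
by rewrite addrACA.
Qed.

Definition scale_entries t B : nat -> 'M[R[i]]_p := fun n => t%:C *: B n.

Lemma adjmx_scale t (M : 'M[R[i]]_p) : (t%:C *: M)^t* = t%:C *: M^t*.
Proof.
apply/matrixP => j k; rewrite !mxE; case: (M k j) => u v.
by apply/eqP; rewrite eq_complex /=; apply/andP; split; apply/eqP; ring.
Qed.

Lemma offdiag_scale t B f : offdiag (scale_entries t B) f = t%:C *: offdiag B f.
Proof.
apply/funext => -[|n]; rewrite scaleseqE ?offdiag0 ?offdiagS /scale_entries.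
  by rewrite scalemxAl.
by rewrite adjmx_scale -!scalemxAl scalerDr.
Qed.

(** Boundedness of the off-diagonal part relative to the diagonal part, stated
    on initial segments so that it makes sense for every sequence. *)
Definition rel_bounded A B t := forall f m,
  \sum_(0 <= k < m) vnorm (offdiag B f k) ^+ 2 <=
  t ^+ 2 * \sum_(0 <= k < m.+1) vnorm (A k *m f k) ^+ 2.

Lemma rel_bounded_l2 A B t f : 0 <= t -> rel_bounded A B t -> l2 (diag_map A f) ->
  l2 (offdiag B f) /\ l2norm (offdiag B f) <= t * l2norm (diag_map A f).
Proof.
move=> t0 hB lA; have h n : \sum_(0 <= k < n) vnorm (offdiag B f k) ^+ 2 <=
    (t * l2norm (diag_map A f)) ^+ 2.
  apply: le_trans (hB f n) _; rewrite exprMn; apply: ler_wpM2l (sqr_ge0 t) _ _ _.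
  exact: l2norm_sum.
split; first exact: l2_bounded h.
by apply: l2norm_le h; rewrite mulr_ge0 ?l2norm_ge0.
Qed.

Lemma rel_bounded_scale A B s t : rel_bounded A B t ->
  rel_bounded A (scale_entries s B) (s * t).
Proof.
move=> hB f m; rewrite offdiag_scale exprMn -mulrA.
have -> : \sum_(0 <= k < m) vnorm ((s%:C *: offdiag B f) k) ^+ 2 =
    s ^+ 2 * \sum_(0 <= k < m) vnorm (offdiag B f k) ^+ 2.
  rewrite mulr_sumr; apply: eq_bigr => k _; rewrite scaleseqE vnorm_scale exprMn.
  by rewrite /= expr0n addr0 sqrtr_sqr real_normK ?num_real.
by apply: ler_wpM2l (sqr_ge0 s) _ _ _; exact: hB.
Qed.

(** The block of [offdiag B] from the site [n] to [n.+1], composed with the inverse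
    of [A n], has norm at most [alpha n], and the block from [n] to [n.-1] norm at
    most [beta n].  Then [a] bounds the sum of the blocks leaving a site and [b]
    that of the blocks entering one.  The Cauchy-Schwarz inequality at each
    site, with weights [alpha] and [beta], produces [b], and collecting the
    squares produces [a]. *)
Lemma schur_test A B (alpha beta : nat -> R) (a b t : R) :
  (forall n, 0 <= alpha n) -> (forall n, 0 <= beta n) ->
  (forall n u, vnorm ((B n)^t* *m u) <= alpha n * vnorm (A n *m u)) ->
  (forall n u, vnorm (B n *m u) <= beta n.+1 * vnorm (A n.+1 *m u)) ->
  (forall n, alpha n + beta n <= a) ->
  beta 1%N <= b -> (forall n, alpha n + beta n.+2 <= b) ->
  a * b <= t ^+ 2 ->
  rel_bounded A B t.
Proof.
move=> al0 be0 hal hbe hrow hcol1 hcol abt f.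
pose w k := vnorm (A k *m f k) ^+ 2.
have w0 k : 0 <= w k by exact: sqr_ge0.
have b0 : 0 <= b by exact: le_trans (be0 1%N) hcol1.
pose from_left k := if k is j.+1 then alpha j * w j else 0.
pose from_right k := beta k.+1 * w k.+1.
have al_w k : 0 <= alpha k * w k by rewrite mulr_ge0.
have be_w k : 0 <= beta k * w k by rewrite mulr_ge0.
have left0 k : 0 <= from_left k by case: k => [|k] /=.
have pointwise k : vnorm (offdiag B f k) ^+ 2 <= b * (from_left k + from_right k).
  case: k => [|k].
    rewrite add0r offdiag0 /from_right /w.
    have := hbe 0%N (f 1%N); rewrite -ler_sqr ?nnegrE ?mulr_ge0 ?vnorm_ge0 //.
    move=> h; apply: le_trans h _; rewrite exprMn expr2 -mulrA.
    by apply: ler_wpM2r hcol1; rewrite mulr_ge0 ?sqr_ge0.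
  rewrite offdiagS /from_left /from_right /w.
  have := le_trans (vnormD _ _) (lerD (hal k (f k)) (hbe k.+1 (f k.+2))).
  rewrite -ler_sqr ?nnegrE ?addr_ge0 ?mulr_ge0 ?vnorm_ge0 //.
  move=> h; apply: le_trans h _.
  move: (vnorm (A k *m _)) (vnorm (A k.+2 *m _)) (hcol k) (al0 k) (be0 k.+2).
  move: (alpha k) (beta k.+2) => x y u v xyb x0 y0.
  apply: (@le_trans _ _ ((x + y) * (x * u ^+ 2 + y * v ^+ 2))).
    rewrite -subr_ge0 (_ : _ - _ = x * y * (u - v) ^+ 2); last by ring.
    exact: mulr_ge0 (mulr_ge0 x0 y0) (sqr_ge0 _).
  apply: ler_wpM2r xyb.
  exact: addr_ge0 (mulr_ge0 x0 (sqr_ge0 _)) (mulr_ge0 y0 (sqr_ge0 _)).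
move=> m; apply: (@le_trans _ _ (b * \sum_(0 <= k < m) (from_left k + from_right k))).
  by rewrite mulr_sumr; apply: ler_sum => k _; exact: pointwise.
apply: (@le_trans _ _ (b * (\sum_(0 <= k < m.+1) (alpha k + beta k) * w k))).
  apply: ler_wpM2l => //; under [leRHS]eq_bigr do rewrite mulrDl.
  rewrite !big_split /=; apply: lerD.
    apply: (@le_trans _ _ (\sum_(0 <= k < m.+1) from_left k)).
      by rewrite big_nat_recr //= lerDl.
    rewrite [leLHS]big_nat_recl //= add0r.
    by rewrite big_nat_recr //= lerDl.
  have -> : \sum_(0 <= k < m.+1) beta k * w k =
      beta 0%N * w 0%N + \sum_(0 <= k < m) from_right k by rewrite big_nat_recl.
  by rewrite lerDr.
apply: (@le_trans _ _ (b * (a * \sum_(0 <= k < m.+1) w k))).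
  apply: ler_wpM2l => //; rewrite mulr_sumr; apply: ler_sum => k _.
  exact: ler_wpM2r (hrow k).
by rewrite mulrA (mulrC b); apply: ler_wpM2r abt; exact: sumr_ge0.
Qed.

Lemma injective_unitmx (M : 'M[R[i]]_p) :
  (forall u : 'cV[R[i]]_p, M *m u = 0 -> u = 0) -> M \in unitmx.
Proof.
move=> hM; rewrite -unitmx_tr unitmxE unitfE; apply/det0P => -[v v0 vM].
move/eqP: v0; apply; apply: trmx_inj; rewrite trmx0; apply: hM.
by apply: trmx_inj; rewrite trmx_mul trmxK trmx0.
Qed.

Lemma vnorm_shift (M : 'M[R[i]]_p) c (u : 'cV[R[i]]_p) : M = M^t* ->
  vnorm (M *m u - c%:C *: ('i%C *: u)) ^+ 2 = vnorm (M *m u) ^+ 2 + c ^+ 2 * vnorm u ^+ 2.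
Proof.
move=> hM; have uu : rdot ('i%C *: u) ('i%C *: u) = rdot u u.
  by rewrite rdot_i scalerA -expr2 sqr_i scaleN1r rdotNr opprK.
have Mu0 : rdot (M *m u) ('i%C *: u) = 0.
  suff : rdot (M *m u) ('i%C *: u) = - rdot (M *m u) ('i%C *: u).
    by move: (rdot _ _) => x; lra.
  by rewrite {1}rdot_adj -hM -scalemxAr (rdotC (M *m u)) rdot_i opprK.
rewrite !vnormE !(rdotDl, rdotDr, rdotNl, rdotNr, rdotZl, rdotZr).
rewrite (rdotC ('i%C *: u) (M *m u)) Mu0 uu.
by move: (rdot (M *m u) _) (rdot u u) => *; ring.
Qed.

Lemma unitmx_shift (M : 'M[R[i]]_p) c : M = M^t* -> c != 0 ->
  M - (c%:C * 'i%C)%:M \in unitmx.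
Proof.
move=> hM c0; apply: injective_unitmx => u.
rewrite mulmxBl mul_scalar_mx -scalerA => hu; apply: vnorm_eq0; apply/eqP.
have := vnorm_shift c u hM; rewrite hu vnorm0 expr0n /=.
move: (sqr_ge0 (vnorm (M *m u))) (mulr_ge0 (sqr_ge0 c) (sqr_ge0 (vnorm u))) => x0 y0 xy.
have /eqP : c ^+ 2 * vnorm u ^+ 2 = 0.
  by move: x0 y0 xy; move: (_ ^+ 2) (_ * _) => *; lra.
by rewrite mulf_eq0 !sqrf_eq0 (negPf c0).
Qed.

#[local] Opaque l2 l2norm ip jacobi_map shifted.

(** Neglecting the off-diagonal part, the equation is solved site by site, and the
    relative bound makes the neglected part a fraction of the datum. *)
Lemma dense_range_rel_lt1 A B c t : (forall n, A n = (A n)^t*) -> c != 0 ->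
  0 <= t < 1 -> rel_bounded A B t -> dense_range A B c.
Proof.
move=> hA c0 t01 hB; apply: (dense_range_contraction t01) => h fh e e0.
have /andP[t0 t1] := t01.
pose y : vseq R p := fun n => invmx (A n - (c%:C * 'i%C)%:M) *m h n.
have yE n : A n *m y n - c%:C *: ('i%C *: y n) = h n.
  by rewrite scalerA -mul_scalar_mx -mulmxBl mulKVmx // unitmx_shift.
have fy : finitely_supported y.
  by have [m hm] := fh; exists m => n mn; rewrite /y hm // mulmx0.
have [lA nA] : l2 (diag_map A y) /\ l2norm (diag_map A y) <= l2norm h.
  apply: l2_dominated => [|n]; first exact: finitely_supported_l2.
  rewrite -ler_sqr ?nnegrE ?vnorm_ge0 // -yE vnorm_shift // lerDl.
  by rewrite mulr_ge0 ?sqr_ge0.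
have [_ nS] := rel_bounded_l2 t0 hB lA.
exists y => //; have -> : h - shifted A B c y = - offdiag B y.
  rewrite shiftedE jacobi_map_split; apply/funext => n.
  rewrite [LHS](_ : _ = h n - (A n *m y n + offdiag B y n - c%:C *: ('i%C *: y n))) //.
  by rewrite addrAC yE opprD addrA subrr add0r.
rewrite l2normN; apply: le_trans nS _.
by apply: le_trans (ler_wpM2l t0 nA) _; rewrite lerDl ltW.
Qed.

Lemma shifted_scale_entries A B c s y :
  shifted A B c y = shifted A (scale_entries (1 - s) B) c y + s%:C *: offdiag B y.
Proof.
rewrite !shiftedE !jacobi_map_split offdiag_scale rmorphB rmorph1 scalerBl scale1r.
by rewrite [RHS]addrAC; congr (_ + _); rewrite -addrA subrK.
Qed.

(** If [v] is no longer than [h] and nearly orthogonal to it, then [(h - v) / 2]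
    has norm about [sqrt (1 / 2) * l2norm h] at most; [3 / 4] leaves room for the
    error terms. *)
Lemma half_residual h v E (d e k : R) : l2 h -> l2 v -> l2 E ->
  0 < d <= e -> l2norm v <= l2norm h + d -> l2norm E < d ->
  - ip h v <= k -> k * 4 <= e ^+ 2 -> l2norm h * d * 2 + d ^+ 2 <= e ^+ 2 / 2 ->
  l2norm ((2^-1)%:C *: ((h - v) + E)) <= 3 / 4 * l2norm h + e.
Proof.
move=> lh lv lE /andP[d0 de] nv nE hv ke de2; have lhv := l2B lh lv.
have nhv : l2norm (h - v) ^+ 2 = l2norm h ^+ 2 - ip h v - (ip h v - l2norm v ^+ 2).
  rewrite -(ip_norm lhv) (ipDl lh (l2N lv) lhv) (ipNl lv lhv).
  rewrite (ipDr lh (l2N lv) lh) (ipDr lh (l2N lv) lv) (ipNr lv lh) (ipNr lv lv).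
  by rewrite (ipC v h) (ip_norm lh) (ip_norm lv).
rewrite (l2normZ _ (l2D lhv lE)).
have -> : Normc.normc (2^-1)%:C = 2^-1 :> R.
  by rewrite /= expr0n addr0 sqrtr_sqr ger0_norm.
have := l2normD lhv lE; have := l2norm_ge0 (h - v).
move: (l2norm_ge0 h) (l2norm_ge0 v) nv nE hv de2 nhv {lh lv lE lhv}.
move: (l2norm h) (l2norm v) (l2norm E) (l2norm (h - v)) (l2norm (h - v + E)) (ip h v).
move=> H V E' D DE x H0 V0 HV Ed xk Hd DE2 D0 le.
have e0 : 0 <= e by lra.
have V2 : V ^+ 2 <= (H + d) ^+ 2 by rewrite ler_sqr ?nnegrE // addr_ge0 // ltW.
have He : 0 <= H * e by exact: mulr_ge0.
have : D <= 3 / 2 * H + e.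
  rewrite -ler_sqr ?nnegrE ?addr_ge0 ?mulr_ge0 //.
  rewrite DE2 (_ : (3 / 2 * H + e) ^+ 2 = 9 / 4 * H ^+ 2 + 3 * (H * e) + e ^+ 2); last by field.
  have H2 := sqr_ge0 H; move: V2; rewrite sqrrD => V2; lra.
lra.
Qed.

(** The borderline case follows Wüst: solving with the coupling scaled by
    [1 - s] leaves a residual of norm at most that of [h] which tends weakly to
    [0] with [s]; half of that solution then has a residual smaller than [h]. *)
Lemma dense_range_rel_le1 A B c t : (forall n, A n = (A n)^t*) -> c != 0 ->
  0 <= t <= 1 -> rel_bounded A B t -> dense_range A B c.
Proof.
move=> hA c0 /andP[t0 t1] hB.
apply: (@dense_range_contraction _ _ _ _ _ (3 / 4)) => [|h fh e e0].
  by apply/andP; split; lra.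
have cn0 : 0 < `|c| by rewrite normr_gt0.
have fSh : finitely_supported (offdiag B h) by exact: finitely_supported_jacobi.
have lh := finitely_supported_l2 fh; have lSh := finitely_supported_l2 fSh.
have H0 := l2norm_ge0 h.
pose H := l2norm h; pose L := l2norm (offdiag B h) / `|c|.
have L0 : 0 <= L by rewrite divr_ge0 ?l2norm_ge0.
have [d [s [/andP[d0 de] d2 /andP[s0 s1] sK]]] := small_parameters H0 L0 e0.
have hst : 0 <= (1 - s) * t < 1.
  clear -t0 t1 s0 s1; by apply/andP; split; nra.
have hD := dense_range_rel_lt1 hA c0 hst (rel_bounded_scale (1 - s) hB).
have [z fz hz] := hD _ fh _ d0.
have lz := finitely_supported_l2 fz.
have [E eE] : exists E, E = h - shifted A (scale_entries (1 - s) B) c z by eexists.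
rewrite -eE in hz.
have lE : l2 E.
  rewrite eE; apply: finitely_supported_l2; apply: finitely_supportedB => //.
  exact: finitely_supported_shifted.
have [S eS] : exists S, S = offdiag B z by eexists.
have lS : l2 S by rewrite eS; apply: finitely_supported_l2; exact: finitely_supported_jacobi.
have lAz : l2 (diag_map A z).
  apply: finitely_supported_l2; have [m hm] := fz; exists m => n mn.
  by rewrite /diag_map hm ?mulmx0.
have [_ SA] := rel_bounded_l2 t0 hB lAz; rewrite -eS in SA.
have {t0 t1 hst}SA : l2norm S <= l2norm (diag_map A z).
  by apply: le_trans SA _; rewrite ler_piMl ?l2norm_ge0.
have [hJz hcz] := shifted_bounds (scale_entries (1 - s) B) c hA fz.
have Tz : l2norm (shifted A (scale_entries (1 - s) B) c z) <= H + d.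
  rewrite -[shifted _ _ _ _](subKr h) -eE.
  by apply: le_trans (l2normB lh lE) _; rewrite lerD2l ltW.
have lJz : l2 (jacobi_map A (scale_entries (1 - s) B) z).
  by apply: finitely_supported_l2; exact: finitely_supported_jacobi.
have sS : s * l2norm S <= H + d.
  have : l2norm (diag_map A z) <= (H + d) + (1 - s) * l2norm S.
    have -> : diag_map A z =
        jacobi_map A (scale_entries (1 - s) B) z - (1 - s)%:C *: S.
      by rewrite jacobi_map_split offdiag_scale -eS addrK.
    apply: le_trans (l2normB lJz (l2Z _ lS)) _; apply: lerD.
      exact: le_trans hJz Tz.
    by rewrite (l2normZ _ lS) [Normc.normc _]/= expr0n addr0 sqrtr_sqr ger0_norm // subr_ge0.
  exact: absorb_coupling SA.
have lv : l2 (s%:C *: S) by exact: l2Z.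
have nv : l2norm (s%:C *: S) <= H + d.
  rewrite (l2normZ _ lS) [Normc.normc _]/= expr0n addr0 sqrtr_sqr (gtr0_norm s0).
  exact: sS.
have hv : - ip h (s%:C *: S) <= s * (L * (H + d)).
  rewrite (ipZr s lS lh) eS -mulrN; apply: ler_wpM2l (ltW s0) _ _ _.
  have -> : ip h (offdiag B z) = ip (offdiag B h) z.
    by rewrite /offdiag -jacobi_symmetric // => n; rewrite trmx0 map_mx0.
  apply: le_trans (ler_norm _) _; rewrite normrN; apply: le_trans (ip_le lSh lz) _.
  rewrite /L -mulrA; apply: ler_wpM2l (l2norm_ge0 _) _ _ _.
  by rewrite mulrC ler_pdivlMr // mulrC; exact: le_trans hcz Tz.
exists ((2^-1)%:C *: z); first exact: finitely_supportedZ.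
have -> : h - shifted A B c ((2^-1)%:C *: z) = (2^-1)%:C *: ((h - s%:C *: S) + E).
  rewrite shiftedZ (shifted_scale_entries A B c s z) -eS eE.
  have hh : h = (2^-1)%:C *: (h + h).
    rewrite scalerDr -scalerDl -rmorphD (_ : 2^-1 + 2^-1 = 1 :> R); last by field.
    by rewrite rmorph1 scale1r.
  rewrite {1}hh -scalerBr; congr (_ *: _).
  by rewrite opprD addrACA addrC.
exact: (half_residual lh lv lE (introT andP (conj d0 de)) nv hz hv sK d2).
Qed.

(** Since [|c| ||y||] is at most the norm of the datum, the perturbation adds a
    residual of at most the fraction [k / |c|] of it. *)
Lemma dense_range_bounded A B B' (c k : R) : (forall n, A n = (A n)^t*) ->
  0 <= k < `|c| -> rel_bounded (fun=> 1%:M) B' k ->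
  dense_range A B c -> dense_range A (B + B') c.
Proof.
move=> hA /andP[k0 kc] hB' hD.
have cn0 : 0 < `|c| by exact: le_lt_trans kc.
apply: (@dense_range_contraction _ _ _ _ _ (k / `|c|)) => [|h fh e e0].
  by rewrite divr_ge0 ?normr_ge0 // ltr_pdivrMr // mul1r.
have lh := finitely_supported_l2 fh.
have d0 : 0 < e / 2 by rewrite divr_gt0.
have [z fz hz] := hD _ fh _ d0.
have lz := finitely_supported_l2 fz.
have lT := finitely_supported_l2 (finitely_supported_shifted A B c fz).
have lE := l2B lh lT.
have lS : l2 (offdiag B' z) by apply: finitely_supported_l2; exact: finitely_supported_jacobi.
have zE : diag_map (fun=> 1%:M) z = z by apply/funext => n; rewrite /diag_map mul1mx.
have lz1 : l2 (diag_map (fun=> 1%:M) z) by rewrite zE.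
have [_ nS] := rel_bounded_l2 k0 hB' lz1; rewrite zE in nS.
have [_ hcz] := shifted_bounds B c hA fz.
exists z => //.
have -> : h - shifted A (B + B') c z = (h - shifted A B c z) - offdiag B' z.
  rewrite !shiftedE !jacobi_map_split offdiagD -[RHS]addrA -opprD; congr (_ - _).
  by rewrite addrA [RHS]addrAC.
apply: le_trans (l2normB lE lS) _.
have Tz : l2norm (shifted A B c z) <= l2norm h + e / 2.
  rewrite -[shifted _ _ _ _](subKr h).
  by apply: le_trans (l2normB lh lE) _; rewrite lerD2l ltW.
have nz : k * l2norm z <= k / `|c| * (l2norm h + e / 2).
  rewrite -mulrA; apply: ler_wpM2l k0 _ _ _.
  by rewrite mulrC ler_pdivlMr // mulrC; exact: le_trans hcz Tz.
have k1 : k / `|c| <= 1 by rewrite ler_pdivrMr // mul1r ltW.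
apply: le_trans (lerD (ltW hz) (le_trans nS nz)) _.
rewrite mulrDr addrC -addrA lerD2l [leRHS]splitr lerD2r ler_piMl //; exact: ltW.
Qed.

End Perturbation.

(** * Selfadjointness *)

Section Selfadjointness.
Variables (R : realType) (p : nat) (A B : nat -> 'M[R[i]]_p).
Hypothesis hA : forall n, A n = (A n)^t*.
Implicit Types (f g h y z : vseq R p).

#[local] Opaque l2 l2norm ip jacobi_map shifted.

Lemma opadjoint_anti (T T' : set (vseq R p * vseq R p)) :
  T `<=` T' -> opadjoint T' `<=` opadjoint T.
Proof. by move=> TT' x [lx1 lx2 hx]; split=> [//|//|y /TT' Ty]; exact: hx _ Ty. Qed.

Lemma opclosure_mono (T T' : set (vseq R p * vseq R p)) :
  T `<=` T' -> opclosure T `<=` opclosure T'.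
Proof.
move=> TT' x [lx1 lx2 hx]; split => // e e0; have [y [Ty hy]] := hx e e0.
by exists y; split => //; exact: TT'.
Qed.

Lemma jacobi_fin_op : jacobi_fin A B `<=` jacobi_op A B.
Proof.
by apply: sub_opclosure => x /jacobi_fin_max[lx1 lx2 _]; split.
Qed.

Lemma selfadjoint_jacobi_max : jacobi_op A B = jacobi_max A B ->
  selfadjoint (jacobi_max A B).
Proof.
move=> eJ; split.
  apply: l2_densely_defined => f ff; exists (jacobi_map A B f).
  exact: (@jacobi_fin_max _ _ A B (f, _) (conj ff erefl)).
apply/seteqP; split; last by rewrite -[X in opadjoint X]eJ; exact: jacobi_max_opadjoint.
by apply: opadjoint_jacobi_max => //; exact: jacobi_fin_max.
Qed.

Lemma finitely_supported_diag f : finitely_supported f -> opdom (diag_op A) f.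
Proof.
move=> ff; exists (diag_map A f); split => //=; apply: finitely_supported_l2 => //.
by have [m hm] := ff; exists m => n mn; rewrite /diag_map hm ?mulmx0.
Qed.

Lemma essentially_selfadjoint_restr : jacobi_op A B = jacobi_max A B ->
  essentially_selfadjoint (oprestr (jacobi_op A B) (opdom (diag_op A))).
Proof.
move=> eJ; set T := oprestr _ _.
have finT : jacobi_fin A B `<=` T.
  by move=> x Jx; split; [exact: jacobi_fin_op | case: Jx => fx _; exact: finitely_supported_diag].
have TJ : T `<=` jacobi_op A B by move=> x [].
have Tmax : T `<=` jacobi_max A B by rewrite -eJ.
split; first split.
- apply: l2_densely_defined => f ff; exists (jacobi_map A B f).
  exact: (finT (f, _) (conj ff erefl)).
- by move=> x /Tmax /(jacobi_max_opadjoint hA); exact: opadjoint_anti.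
have -> : opclosure T = jacobi_max A B.
  apply/seteqP; split; first exact: opclosure_jacobi_max.
  by rewrite -eJ; exact: opclosure_mono.
exact: selfadjoint_jacobi_max.
Qed.

End Selfadjointness.

(** Below, [Bf] is the bounded part of the off-diagonal entries and [B] the
    part that is dominated by the diagonal. *)
Section DiagonalDomination.
Variables (R : realType) (p : nat) (A B : nat -> 'M[R[i]]_p).
Variables (Bf : nat -> 'M[R[i]]_p) (t k : R).
Hypothesis hA : forall n, A n = (A n)^t*.
Hypotheses (t0 : 0 <= t) (k0 : 0 <= k).
Hypotheses (hB : rel_bounded A B t) (hBf : rel_bounded (fun=> 1%:M) Bf k).
Implicit Types (f g h y z : vseq R p).

#[local] Opaque l2 l2norm ip jacobi_map shifted.

Lemma bounded_offdiag f : l2 f -> l2 (offdiag Bf f) /\ l2norm (offdiag Bf f) <= k * l2norm f.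
Proof.
move=> lf; have fE : diag_map (fun=> 1%:M) f = f.
  by apply/funext => n; rewrite /diag_map mul1mx.
by have := rel_bounded_l2 (f := f) k0 hBf; rewrite fE; exact.
Qed.

Lemma jacobi_op_max : t <= 1 -> jacobi_op A (B + Bf) = jacobi_max A (B + Bf).
Proof.
move=> t1; apply/seteqP; split.
  by apply: opclosure_jacobi_max => //; exact: jacobi_fin_max.
(* The shift [c] has to exceed the bound [k] of the perturbation. *)
have c0 : 0 < k + 1 by rewrite ltr_wpDl.
have dense (c : R) : `|c| = k + 1 -> dense_range A (B + Bf) c.
  move=> hc; apply: (dense_range_bounded (k := k)) => //.
    by rewrite k0 hc ltrDl ltr01.
  apply: (dense_range_rel_le1 (t := t)) => //; last by rewrite t0.
  by rewrite -normr_gt0 hc.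
apply: (jacobi_max_sub hA c0); apply: dense; rewrite ?normrN gtr0_norm //.
Qed.

Lemma opdom_diag_sub f : opdom (diag_op A) f -> opdom (jacobi_max A (B + Bf)) f.
Proof.
move=> [g [/= lf lg eg]]; exists (jacobi_map A (B + Bf) f); split => //=.
have lD : l2 (diag_map A f) by move: lg; rewrite eg.
rewrite jacobi_map_split offdiagD; apply: l2D => //; apply: l2D.
  by have [] := rel_bounded_l2 t0 hB lD.
by have [] := bounded_offdiag lf.
Qed.

Lemma diag_bound y : t < 1 -> finitely_supported y ->
  l2norm (diag_map A y) <=
  (l2norm (jacobi_map A (B + Bf) y) + k * l2norm y) / (1 - t).
Proof.
move=> t1 fy; have ly := finitely_supported_l2 fy.
have lJ := finitely_supported_l2 (finitely_supported_jacobi A (B + Bf) fy).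
have [g [/= _ lA eg]] := finitely_supported_diag A fy.
have {g eg}lA : l2 (diag_map A y) by move: lA; rewrite eg.
have [lS nS] := rel_bounded_l2 t0 hB lA.
have [lF nF] := bounded_offdiag ly.
have : l2norm (diag_map A y) <= l2norm (jacobi_map A (B + Bf) y) +
    (l2norm (offdiag B y) + l2norm (offdiag Bf y)).
  have {1}-> : diag_map A y = jacobi_map A (B + Bf) y - (offdiag B y + offdiag Bf y).
    by rewrite jacobi_map_split offdiagD addrK.
  apply: le_trans (l2normB lJ (l2D lS lF)) _; rewrite lerD2l; exact: l2normD.
have t1' : 0 < 1 - t by rewrite subr_gt0.
rewrite ler_pdivlMr //.
move: (l2norm (diag_map A y)) (l2norm (offdiag B y)) (l2norm (offdiag Bf y)) nS nF.
move: (l2norm (jacobi_map A (B + Bf) y)) (k * l2norm y) => *; lra.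
Qed.

Lemma truncated_diag_bound m : exists2 C, 0 <= C & forall f, l2 f ->
  let D := diag_map (fun n => if (n < m)%N then A n else 0) f in
  l2 D /\ l2norm D <= C * l2norm f.
Proof.
have C0 : 0 <= \sum_(0 <= n < m) opnorm (A n) by apply: sumr_ge0 => *; exact: opnorm_ge0.
exists (\sum_(0 <= n < m) opnorm (A n)) => // f lf.
set C := \sum_(0 <= n < m) opnorm (A n) in C0 *.
have nC : Normc.normc C%:C = C by rewrite /= expr0n addr0 sqrtr_sqr ger0_norm.
rewrite -[X in X * _]nC -(l2normZ _ lf) /=; apply: l2_dominated => [|n]; first exact: l2Z.
rewrite scaleseqE vnorm_scale nC /diag_map; case: ifP => [nm|_]; last first.
  by rewrite mul0mx vnorm0 mulr_ge0 ?vnorm_ge0.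
apply: le_trans (vnorm_mulmx _ _) _; apply: ler_wpM2r (vnorm_ge0 _) _ _ _.
by apply: term_le_sum => // k'; exact: opnorm_ge0.
Qed.

(** The bound of [diag_bound] passes to the closure: each initial segment of
    [A f] depends continuously on [f]. *)
Lemma opdom_jacobi_sub f : t < 1 -> opdom (jacobi_op A (B + Bf)) f -> opdom (diag_op A) f.
Proof.
move=> t1 [g [/= lf lg cl]]; exists (diag_map A f); split => //=.
have t1' : 0 < 1 - t by rewrite subr_gt0.
pose M := ((l2norm g + 1) + k * (l2norm f + 1)) / (1 - t).
apply: (@l2_bounded _ _ _ (M ^+ 2)) => m.
have [C C0 hC] := truncated_diag_bound m.
pose D := diag_map (fun n => if (n < m)%N then A n else 0).
have [lD _] := hC f lf; rewrite -/(D f) in lD.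
have -> : \sum_(0 <= n < m) vnorm (diag_map A f n) ^+ 2 =
    \sum_(0 <= n < m) vnorm (D f n) ^+ 2.
  by apply: eq_big_nat => n /andP[_ nm]; rewrite /D /diag_map nm.
apply: le_trans (l2norm_sum m lD) _.
have M0 : 0 <= M.
  apply: divr_ge0 (ltW t1').
  exact: addr_ge0 (addr_ge0 (l2norm_ge0 g) ler01) (mulr_ge0 k0 (addr_ge0 (l2norm_ge0 f) ler01)).
rewrite ler_sqr ?nnegrE ?l2norm_ge0 // -subr_le0.
apply: (@le0_epsilonM _ (C + M + l2norm (D f))) => e e0.
have [e1|e1] := leP e 1; last first.
  have : l2norm (D f) <= e * l2norm (D f) by rewrite ler_peMl ?l2norm_ge0 // ltW.
  have : 0 <= e * (C + M) by exact: mulr_ge0 (ltW e0) (addr_ge0 C0 M0).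
  by move: M0; move: (l2norm (D f)) => *; lra.
have [[y Jy] /= [[/= fy eJy] ly lJy h1 h2]] := cl e e0.
have [lDw nDw] := hC _ (l2B lf ly); rewrite -/(D _) in lDw nDw.
have [lDy _] := hC _ ly; rewrite -/(D _) in lDy.
have [g' [/= _ lA eg']] := finitely_supported_diag A fy.
have {g' eg'}lA : l2 (diag_map A y) by move: lA; rewrite eg'.
have DA : l2norm (D y) <= l2norm (diag_map A y).
  have [//|n|//] := @l2_dominated _ _ (D y) (diag_map A y).
  by rewrite /D /diag_map; case: ifP => // _; rewrite mul0mx vnorm0 vnorm_ge0.
have AM : l2norm (diag_map A y) <= M.
  apply: le_trans (diag_bound t1 fy) _; rewrite /M ler_pM2r ?invr_gt0 //; apply: lerD.
    rewrite -eJy -[Jy](subKr g); apply: le_trans (l2normB lg (l2B lg lJy)) _.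
    by rewrite lerD2l (le_trans (ltW h2)).
  apply: ler_wpM2l => //; rewrite -[y](subKr f).
  by apply: le_trans (l2normB lf (l2B lf ly)) _; rewrite lerD2l (le_trans (ltW h1)).
have DD : l2norm (D f) <= C * e + M.
  have -> : D f = D (f - y) + D y.
    apply/funext => n; rewrite [RHS]addseqE /D /diag_map -mulmxDr.
    by rewrite [(f - y) n]/(_ + _) /= subrK.
  apply: le_trans (l2normD lDw lDy) _; apply: lerD; last exact: le_trans DA AM.
  exact: le_trans nDw (ler_wpM2l C0 (ltW h1)).
have : 0 <= e * (M + l2norm (D f)).
  exact: mulr_ge0 (ltW e0) (addr_ge0 M0 (l2norm_ge0 _)).
rewrite lerBlDl => eMD; apply: le_trans DD _.
by rewrite addrC lerD2l mulrC -addrA mulrDr lerDl.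
Qed.

End DiagonalDomination.

(** * The coefficients *)

Section Coefficients.
Variables (R : realType) (p : nat) (A B : nat -> 'M[R[i]]_p).
Hypothesis hA : forall n, A n = (A n)^t*.

Lemma diag_unitmx : opker (diag_op A) = [set 0] -> forall n, A n \in unitmx.
Proof.
move=> hker n; apply: injective_unitmx => u Au0.
pose d : vseq R p := fun k => if k == n then u else 0.
have d0 : d = 0.
  suff : opker (diag_op A) d by rewrite hker.
  split => /=.
  - apply: finitely_supported_l2; exists n.+1 => k nk.
    by rewrite /d ifN //; lia.
  - by apply: finitely_supported_l2; exists 0%N.
  - by apply/funext => k; rewrite /d; case: eqP => [->|_]; rewrite ?Au0 ?mulmx0.
by have := congr1 (fun f => f n) d0; rewrite /d eqxx.
Qed.

(** As [M] is hermitian, [C^* M^-1] is the adjoint of [M^-1 C], and both have the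
    same operator norm. *)
Lemma vnorm_adj_invmx (M C : 'M[R[i]]_p) (u : 'cV[R[i]]_p) :
  M = M^t* -> M \in unitmx ->
  vnorm (C^t* *m u) <= opnorm (invmx M *m C) * vnorm (M *m u).
Proof.
move=> hM uM; have -> : C^t* *m u = (invmx M *m C)^t* *m (M *m u).
  have E : (invmx M)^t* *m M = 1%:M.
    by rewrite [X in _ *m X]hM -map_mxM -trmx_mul mulmxV // trmx1 map_mx1.
  by rewrite trmx_mul map_mxM mulmxA -(mulmxA _ _ M) E mulmx1.
exact: vnorm_adjmx.
Qed.

(** Cutting the finitely many links between the sites [n] and [n.+1], [n <= N],
    makes the row and column bounds available at every site: they are given for
    the rows from [N] on and the columns from [N.+1] on. *)
Definition tail_entries N : nat -> 'M[R[i]]_p := fun n => if (N < n)%N then B n else 0.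

Definition head_entries N : nat -> 'M[R[i]]_p := fun n => if (N < n)%N then 0 else B n.

Lemma tail_head_entries N : B = tail_entries N + head_entries N.
Proof.
apply/funext => n; rewrite [RHS](_ : _ = tail_entries N n + head_entries N n) //.
by rewrite /tail_entries /head_entries; case: ifP; rewrite ?addr0 ?add0r.
Qed.

Lemma head_rel_bounded N : exists2 k, 0 <= k &
  rel_bounded (fun=> 1%:M) (head_entries N) k.
Proof.
pose k := \sum_(0 <= n < N.+1) opnorm (B n).
pose c n := if (N < n)%N then 0 else opnorm (B n).
have k0 : 0 <= k by apply: sumr_ge0 => *; exact: opnorm_ge0.
have c0 n : 0 <= c n by rewrite /c; case: ifP => // _; exact: opnorm_ge0.
have ck n : c n <= k.
  by rewrite /c; case: leqP => // nN; apply: term_le_sum => // j; exact: opnorm_ge0.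
exists (k *+ 2); first by rewrite mulrn_wge0.
apply: (@schur_test _ _ _ _ c (fun n => if n is m.+1 then c m else 0) (k *+ 2) (k *+ 2)).
- exact: c0.
- by case.
- move=> n u; rewrite /c /head_entries mul1mx; case: ifP => _.
    by rewrite trmx0 map_mx0 mul0mx mul0r vnorm0.
  exact: vnorm_adjmx.
- move=> n u; rewrite /c /head_entries mul1mx; case: ifP => _.
    by rewrite mul0mx mul0r vnorm0.
  exact: vnorm_mulmx.
- by case=> [|n]; rewrite mulr2n lerD.
- by rewrite mulr2n ler_wpDl.
- by move=> n; rewrite mulr2n lerD.
- by rewrite expr2.
Qed.

Lemma tail_rel_bounded N (a b : R) : (forall n, A n \in unitmx) ->
  (forall n, (N <= n)%N -> opnorm (invmx (A n) *m B n)
     + opnorm (invmx (A n) *m (prev_entry B n)^t*) <= a) ->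
  (forall n, (N <= n)%N -> opnorm (invmx (A n) *m B n)
     + opnorm (invmx (A n.+2) *m (B n.+1)^t*) <= b) ->
  [/\ 0 <= a, 0 <= b & rel_bounded A (tail_entries N) (Num.sqrt (a * b))].
Proof.
move=> uA ha hb.
have a0 : 0 <= a by apply: le_trans (ha N (leqnn N)); rewrite addr_ge0 ?opnorm_ge0.
have b0 : 0 <= b by apply: le_trans (hb N (leqnn N)); rewrite addr_ge0 ?opnorm_ge0.
split => //.
pose q n := opnorm (invmx (A n) *m B n).
pose r n := opnorm (invmx (A n.+1) *m (B n)^t*).
have q0 n : 0 <= q n by exact: opnorm_ge0.
have r0 n : 0 <= r n by exact: opnorm_ge0.
have row n : (N <= n.+1)%N -> q n.+1 + r n <= a by exact: ha.
have col n : (N <= n)%N -> q n + r n.+1 <= b by exact: hb.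
pose alpha n := if (N < n)%N then q n else 0.
pose beta n := if n is m.+1 then if (N < m)%N then r m else 0 else 0.
have left n u : vnorm ((tail_entries N n)^t* *m u) <= alpha n * vnorm (A n *m u).
  rewrite /alpha /tail_entries; case: ifP => _; first exact: vnorm_adj_invmx.
  by rewrite trmx0 map_mx0 mul0mx mul0r vnorm0.
have right n u : vnorm (tail_entries N n *m u) <= beta n.+1 * vnorm (A n.+1 *m u).
  rewrite /beta /tail_entries; case: ifP => _; last by rewrite mul0mx mul0r vnorm0.
  by rewrite -{1}(trmxCK (B n)); exact: vnorm_adj_invmx.
move: q r q0 r0 row col @alpha @beta left right => q r q0 r0 row col alpha beta left right.
apply: (@schur_test _ _ _ _ alpha beta a b) => //.
- by move=> n; rewrite /alpha; case: ifP.
- by case=> [|n]; rewrite /beta //; case: ifP.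
- case=> [|n]; rewrite /alpha /beta; first by rewrite addr0.
  case: (ltnP N n.+1) => Nn; last by rewrite ifN ?addr0 //; lia.
  apply: le_trans (row n (ltnW Nn)); rewrite lerD2l.
  by case: ifP.
- move=> n; rewrite /alpha /beta; case: (leqP N n) => Nn.
    rewrite ltnS Nn; apply: le_trans (col n Nn); rewrite lerD2r.
    by case: ifP.
  by rewrite !ifN ?addr0 //; lia.
- by rewrite sqr_sqrtr // mulr_ge0.
Qed.

End Coefficients.

Theorem theorem2p2 (R : realType) (p : nat) (hp : (0 < p)%N)
    (A B : nat -> 'M[R[i]]_p)
    (hA : forall n, A n = (A n)^t*)
    (hB : forall n, B n \in unitmx)
    (hker : opker (diag_op A) = [set 0])
    (N : nat)
    (ha1 : (a1 A B N < +oo)%E)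
    (ha2 : (a2 A B N < +oo)%E) :
  ((a1 A B N * a2 A B N <= 1)%E ->
     opdom (diag_op A) `<=` opdom (jacobi_op A B) /\
     essentially_selfadjoint
       (oprestr (jacobi_op A B) (opdom (diag_op A)))) /\
  ((a1 A B N * a2 A B N < 1)%E ->
     opdom (jacobi_op A B) = opdom (diag_op A) /\
     selfadjoint (jacobi_op A B)).
Proof.
have uA := diag_unitmx hker.
have [a aE ha] := ereal_sup_lty ha1; have [b bE hb] := ereal_sup_lty ha2.
rewrite /a1 aE /a2 bE -EFinM lee_fin lte_fin.
have [a0 b0 hT] := tail_rel_bounded hA uA ha hb.
have [k k0 hH] := head_rel_bounded B N.
have t0 : 0 <= Num.sqrt (a * b) by exact: sqrtr_ge0.
have ab0 : 0 <= a * b by exact: mulr_ge0.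
have max : a * b <= 1 -> jacobi_op A B = jacobi_max A B.
  move=> ab1; rewrite (tail_head_entries B N).
  by apply: (jacobi_op_max hA t0 k0 hT hH); rewrite -sqrtr1 ler_wsqrtr.
have sub f : opdom (diag_op A) f -> opdom (jacobi_max A B) f.
  by rewrite (tail_head_entries B N); exact: (opdom_diag_sub t0 k0 hT hH).
split => ab1.
  split; first by rewrite (max ab1).
  exact: (essentially_selfadjoint_restr hA (max ab1)).
have mx := max (ltW ab1); split; last by rewrite mx; exact: selfadjoint_jacobi_max.
apply/seteqP; split; last by rewrite mx.
rewrite (tail_head_entries B N); move=> f; apply: (opdom_jacobi_sub t0 k0 hT hH).
by rewrite -sqrtr1 ltr_sqrt.
Qed.
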